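(* Let $L,T,\omega,b\in(0,\infty)$, let $\mathbf{e_g}\in\mathbb{R}^3$ with $|\mathbf{e_g}|=1$, and let $\mathbf f:[0,L]\times[0,T]\to\mathbb{R}^3$ be continuous. For $N\in\mathbb{N}$ and $\tau=T/N$ let $(\mathbf r_k)_{k=0}^N$ be the discrete fiber solution defined in the context and let $\mathbf r^\tau\in\mathcal{H}^{2,1}(\Omega;\mathbb{R}^3)$ be its piecewise linear in time interpolation. Then there exists a constant $0<R<\infty$, independent of $N\in\mathbb{N}$ (equivalently, of the time step $\tau>0$), such that $$\int_0^L\big(|(\partial_s\mathbf r^\tau)_N|^2-1\big)\,ds\le R\sqrt\tau .$$
   Context: $\Omega_L=(0,L)$, $\Omega_T=(0,T)$, $\Omega=\Omega_L\times\Omega_T$. $\mathcal{H}^{2,1}(\Omega;\mathbb{R}^3)$ is the space of functions on $\Omega$ twice weakly differentiable in $s$, once weakly differentiable in $t$, square integrable together with these derivatives. For $N\in\mathbb{N}$ let $\tau=T/N$, $t_k=k\tau$, $\mathbf f_k=\mathbf f(\cdot,t_k)$. Let $\mathcal V=\{\mathbf v\in\mathcal{H}^2(\Omega_L;\mathbb{R}^3):\mathbf v(L)=\mathbf 0,\ \partial_s\mathbf v(L)=-\mathbf{e_g}\}$. Set $\mathbf r_0(s)=\mathbf r_1(s)=(L-s)\mathbf{e_g}$. Recursively for $k=1,\dots,N-1$, given $\mathbf r_{k-1},\mathbf r_k\in\mathcal V$, put $\mathrm D^2_{k+1}\mathbf v=(\mathbf v-2\mathbf r_k+\mathbf r_{k-1})/\tau^2$,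 $$J_{k+1}(\mathbf v)=\omega\|\tau\mathrm D_{k+1}^2\mathbf v\|^2_{\mathcal{L}^2(\Omega_L)}+b\|\partial_{ss}\mathbf v\|^2_{\mathcal{L}^2(\Omega_L)}-2(\mathbf f_{k+1},\mathbf v)_{\mathcal{L}^2(\Omega_L)},\quad e_{k+1}(\mathbf v)=2\,\partial_s(\mathbf v-\mathbf r_k)\cdot\partial_s\mathbf r_k,$$ $\mathcal K_{k+1}=\{\mathbf v\in\mathcal V: e_{k+1}(\mathbf v)=0\}$, and let $\mathbf r_{k+1}$ be the unique minimizer of $J_{k+1}$ over $\mathcal K_{k+1}$. Interpolation: $\mathbf r^\tau(s,t)=\frac{t-t_{k-1}}{\tau}(\mathbf r_k-\mathbf r_{k-1})(s)+\mathbf r_{k-1}(s)$ for $t\in(t_{k-1},t_k]$, $k=1,\dots,N$. A subindex $k$ on a function of time denotes its value at $t_k$; thus $(\partial_s\mathbf r^\tau)_N=\partial_s\mathbf r_N$. *)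

(* Defs.v *)
(* MathComp-Analysis *)
From HB Require Import structures.
From mathcomp Require Import all_boot all_order all_algebra.
From mathcomp Require Import all_classical all_reals all_analysis.

Set Implicit Arguments.
Unset Strict Implicit.
Unset Printing Implicit Defensive.

Import Order.TTheory GRing.Theory Num.Theory.
Import numFieldNormedType.Exports.

Local Open Scope classical_set_scope.
Local Open Scope ring_scope.

(* The library norm on ['rV[R]_3] is the max norm, so the Euclidean structure
   is defined here. *)
Definition dotv (R : realType) (u v : 'rV[R]_3) : R :=
  \sum_(i < 3) u 0 i * v 0 i.

Definition enorm (R : realType) (u : 'rV[R]_3) : R := Num.sqrt (dotv u u).

(* A function on the interval (0, L) or [0, L] is a total function on [R]
   whose values outside the interval are irrelevant. *)
Definition L2 (R : realType) (L : R) (u : R -> 'rV[R]_3) : Prop :=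
  forall i : 'I_3,
    (fun s => u s 0 i) \_ `]0, L[ \in Lfun (@lebesgue_measure R) 2%:E.

Definition L2dot (R : realType) (L : R) (u v : R -> 'rV[R]_3) : R :=
  \int[@lebesgue_measure R]_(s in `]0, L[) dotv (u s) (v s).

Definition L2normsq (R : realType) (L : R) (u : R -> 'rV[R]_3) : R :=
  L2dot L u u.

(* The space of test functions C_c^oo(0, L); a closed subset of the bounded
   interval ]0, L[ is compact. *)
Definition test_function (R : realType) (L : R) (phi : R -> R) : Prop :=
  (forall (n : nat) (s : R), derivable (derive1n n phi) s 1) /\
  closure [set s | phi s != 0] `<=` `]0, L[.

Definition weak_derivative (R : realType) (L : R) (u g : R -> 'rV[R]_3) :
    Prop :=
  L2 L g /\
  forall (phi : R -> R) (i : 'I_3), test_function L phi ->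
    \int[@lebesgue_measure R]_(s in `]0, L[) (u s 0 i * derive1 phi s) =
    - \int[@lebesgue_measure R]_(s in `]0, L[) (g s 0 i * phi s).

Definition H2 (R : realType) (L : R) (v : R -> 'rV[R]_3) : Prop :=
  L2 L v /\
  exists v1 v2, weak_derivative L v v1 /\ weak_derivative L v1 v2.

(* Weak derivatives are only determined almost everywhere.  As H^2(0, L) embeds
   into C^1([0, L]), [ds] selects the representative of the first derivative
   that is continuous on [0, L], which is unique there, so that pointwise values
   such as those at [L] make sense. *)
Definition ds (R : realType) (L : R) (v : R -> 'rV[R]_3) : R -> 'rV[R]_3 :=
  xget (cst 0) [set g | weak_derivative L v g /\
                        {within `[0, L], continuous g}].

(* Any representative: only integrals of [dss] are used. *)
Definition dss (R : realType) (L : R) (v : R -> 'rV[R]_3) : R -> 'rV[R]_3 :=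
  xget (cst 0) [set g | weak_derivative L (ds L v) g].

(* An element of H^2(0, L) with boundary conditions is given by its continuous
   representative. *)
Definition calV (R : realType) (L : R) (eg : 'rV[R]_3) (v : R -> 'rV[R]_3) :
    Prop :=
  [/\ H2 L v, {within `[0, L], continuous v}, v L = 0 & ds L v L = - eg].

(* In the next definitions [rm] and [rk] are the two previous time levels
   r_(k-1) and r_k, [v] is a candidate for r_(k+1), and [fk] is the load at
   time t_(k+1). *)
Definition D2 (R : realType) (tau : R) (rm rk v : R -> 'rV[R]_3) :
    R -> 'rV[R]_3 :=
  fun s => (tau ^+ 2)^-1 *: (v s - 2 *: rk s + rm s).

Definition J (R : realType) (L w b tau : R) (fk rm rk v : R -> 'rV[R]_3) : R :=
  w * L2normsq L (fun s => tau *: D2 tau rm rk v s)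
  + b * L2normsq L (dss L v) - 2 * L2dot L fk v.

Definition e_constraint (R : realType) (L : R) (rk v : R -> 'rV[R]_3) : R -> R :=
  fun s => 2 * dotv (ds L (v \- rk) s) (ds L rk s).

Definition calK (R : realType) (L : R) (eg : 'rV[R]_3)
    (rk v : R -> 'rV[R]_3) : Prop :=
  calV L eg v /\ forall s, s \in `]0, L[ -> e_constraint L rk v s = 0.

Definition is_minimizer (X : Type) (R : realType) (F : X -> R) (K : X -> Prop)
    (x : X) : Prop :=
  K x /\ forall y, K y -> F x <= F y.

(* Only [r 0], ..., [r N] are constrained. *)
Definition discrete_solution (R : realType) (L T w b : R) (eg : 'rV[R]_3)
    (f : R * R -> 'rV[R]_3) (N : nat) (r : nat -> R -> 'rV[R]_3) : Prop :=
  let tau := T / N%:R in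
  [/\ forall s, s \in `[0, L] -> r 0%N s = (L - s) *: eg,
      forall s, s \in `[0, L] -> r 1%N s = (L - s) *: eg &
      forall k : nat, (1 <= k < N)%N ->
        is_minimizer
          (J L w b tau (fun s => f (s, k.+1%:R * tau)) (r k.-1) (r k))
          (calK L eg (r k)) (r k.+1)].

(* For t > 0, [k] is the index with t_(k-1) < t <= t_k. *)
Definition interpolation (R : realType) (tau : R) (r : nat -> R -> 'rV[R]_3)
    (s t : R) : 'rV[R]_3 :=
  let k := `|Num.ceil (t / tau)|%N in
  ((t - k.-1%:R * tau) / tau) *: (r k s - r k.-1 s) + r k.-1 s.

(* Main.v *)
Require Import Defs.
From HB Require Import structures.
From mathcomp Require Import all_boot all_order all_algebra.
From mathcomp Require Import all_classical all_reals all_analysis.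
From mathcomp Require Import measurable_realfun ring lra.
Import Order.TTheory GRing.Theory Num.Theory.
Import numFieldNormedType.Exports.
Local Open Scope classical_set_scope.
Local Open Scope ring_scope.

Set Implicit Arguments.
Unset Strict Implicit.

(** Put [tau = T / N], [d_k = r_k - r_(k-1)] and let [d_k'], [d_k''] be its
    derivatives.  The segment from [r_(k+1)] to [r_k] lies in the constraint
    set, so the derivative of [J] along it vanishes at [r_(k+1)].  This gives a
    discrete energy inequality, whence [sum_k |d_k''|^2] is bounded and
    [sum_k |d_k|^2 <= c tau], uniformly in [N].  The constraint makes [d_(k+1)']
    pointwise orthogonal to [r_k'], so the violation of arclength telescopes to
    [sum_k |d_k'|^2].  As [d_k] and [d_k'] vanish at [L], integrating
    [(a u'' + u' + u / a)^2 >= 0] gives the Hardy-Littlewood inequality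
    [|u'|^2 <= a^2 |u''|^2 + a^-2 |u|^2] for [u = d_k]; take [a^2 = sqrt tau].

    The analysis behind this is the one-dimensional theory of [H^2]: a weak
    derivative is unique almost everywhere, and a continuous function is the
    primitive of its integrable weak derivative. *)

(** * Smooth bump functions *)

(** The constraint is linear in v - r_k, so the admissible set is affine and contains r_k itself;
    hence the comparison along a line. Testing with the increment, and not an arbitrary variation,
    turns each inner product into a difference of squares plus a square. The extra square of the
    bending term, the dissipation of the implicit scheme, is what bounds the sum of |d_k''|^2. The
    Hardy-Littlewood inequality then sums to a^2 O(1) + a^-2 O(tau), and a^2 = sqrt tau balances the
    two.

    Two obstacles shape the rest. As d_k'' is merely square integrable, integration by parts is
    derived from Fubini's theorem for primitives of integrable functions. And [ds], [dss] are
    choices, so even their linearity rests on the uniqueness of weak derivatives. *)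

Lemma scaleRE (R : realType) (a b : R) : a *: b = a * b.
Proof. by []. Qed.

(** The power of 1/x is a parameter because differentiating exp(-1/x) creates such factors: the
    derivative at index [n] involves only the indices [n.+1] and [n.+2]. *)
Definition flat_exp (R : realType) (n : nat) (x : R) : R :=
  if 0 < x then x^-1 ^+ n * expR (- x^-1) else 0.

(** For x > 0 and y = 1/x, use exp(y) >= y^(n+2) / (n+2)!. Quadratic decay makes the difference
    quotient at 0 tend to 0. *)
Lemma flat_exp_le_sqr (R : realType) (n : nat) (x : R) :
  `|flat_exp n x| <= (n.+2)`!%:R * x ^+ 2.
Proof.
rewrite /flat_exp; case: ifPn => [x0|_]; last by rewrite normr0 mulr_ge0// sqr_ge0.
have xV : 0 < x^-1 by rewrite invr_gt0.
have f0 : 0 < (n.+2)`!%:R :> R by rewrite ltr0n fact_gt0.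
rewrite ger0_norm; last by rewrite mulr_ge0 ?exprn_ge0 ?expR_ge0 ?ltW.
have := expR_ge1Dxn n.+1 (ltW xV) => H.
rewrite expRN ler_pdivrMr ?expR_gt0//.
have -> : x^-1 ^+ n = (n.+2)`!%:R * x ^+ 2 * (x^-1 ^+ n.+2 / (n.+2)`!%:R).
  have xn : x != 0 by rewrite gt_eqF.
  have fn : (n.+2)`!%:R != 0 :> R by rewrite gt_eqF.
  rewrite -addn2 exprD !exprVn; field.
  by rewrite expf_neq0 // xn addn2 fn.
rewrite ler_wpM2l//; first by rewrite mulr_ge0// ?ltW// ?exprn_gt0.
by apply: le_trans H; rewrite lerDr.
Qed.

Lemma is_derive_flat_exp (R : realType) (n : nat) (x : R) :
  is_derive x 1 (flat_exp n)
    (flat_exp n.+2 x - n%:R * flat_exp n.+1 x).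
Proof.
case: (ltgtP x 0) => [x0|x0|->].
- rewrite /flat_exp ltNge (ltW x0)/= mulr0 subr0.
  apply: (@near_eq_is_derive _ _ _ (cst 0)).
    have := lt_nbhsl x0; apply: filterS => y y0.
    by rewrite ltNge (ltW y0).
- apply: (@near_eq_is_derive _ _ _
    (((fun y : R => y^-1) ^+ n) * (expR \o (fun y : R => - y^-1)))).
    have := lt_nbhsr x0; apply: filterS => y y0.
    by rewrite /flat_exp y0 /= !fctE.
  have dV : is_derive x 1 (fun y : R => y^-1) (- x ^- 2).
    apply: (is_derive_eq (@is_deriveV _ id x 1 1 (lt0r_neq0 x0) (is_derive_id x 1))).
    by rewrite scaleRE mulr1.
  have dN : is_derive x 1 (fun y : R => - y^-1) (x ^- 2).
    by apply: (is_derive_eq (is_deriveN dV)); rewrite opprK.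
  have dE := @is_derive1_comp _ expR (fun y : R => - y^-1) x _ _ (is_derive_expR _) dN.
  apply: (is_derive_eq (is_deriveM (is_deriveX n dV) dE)).
  rewrite /flat_exp x0 !fctE/= !scaleRE.
  case: n => [|n] /=; first by rewrite !expr0 !exprVn; ring.
  by rewrite /= !exprS; field; rewrite gt_eqF.
- have -> : flat_exp n.+2 (0:R) - n%:R * flat_exp n.+1 0 = 0.
    by rewrite /flat_exp ltxx mulr0 subr0.
  have H : h^-1 *: (flat_exp n (h *: 1 + 0) - flat_exp n 0) @[h --> (0:R)^'] --> (0:R).
    apply/cvgr0Pnorm_le => e e0; near=> h.
    have h0 : h != 0 by near: h; exact: nbhs_dnbhs_neq.
    rewrite {2}/flat_exp ltxx subr0 addr0 !scaleRE mulr1.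
    rewrite normrM normfV mulrC ler_pdivrMr ?normr_gt0//.
    apply: (le_trans (flat_exp_le_sqr n h)).
    rewrite -[h ^+ 2]ger0_norm ?sqr_ge0// normrX expr2 mulrA ler_wpM2r//.
    rewrite mulrC -ler_pdivlMr ?ltr0n ?fact_gt0//.
    near: h; apply: dnbhs0_le; rewrite divr_gt0// ltr0n fact_gt0//.
  apply: DeriveDef; first by apply/cvg_ex; exists 0.
  by apply/cvg_lim.
Unshelve. all: by end_near. Qed.

(* Closed under differentiation, so all its members are smooth. *)
Inductive flat_fun (R : realType) : (R -> R) -> Prop :=
| Flat_exp n k a : flat_fun (fun x => flat_exp n (k * (x - a)))
| Flat_add f g : flat_fun f -> flat_fun g -> flat_fun (fun x => f x + g x)
| Flat_scale c f : flat_fun f -> flat_fun (fun x => c * f x)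
| Flat_mul f g : flat_fun f -> flat_fun g -> flat_fun (fun x => f x * g x).

Lemma flat_is_derive (R : realType) (f : R -> R) : flat_fun f ->
  exists2 g : R -> R, flat_fun g & forall x : R, is_derive x 1 f (g x).
Proof.
elim => [n k a|{}f g _ [f' Ff' df] _ [g' Fg' dg]|c {}f _ [f' Ff' df]|
  {}f g Ff [f' Ff' df] Fg [g' Fg' dg]].
- exists (fun x => k * (flat_exp n.+2 (k * (x - a)) +
                   (- n%:R) * flat_exp n.+1 (k * (x - a)))).
    by apply: Flat_scale; apply: Flat_add; [|apply: Flat_scale]; exact: Flat_exp.
  move=> x.
  have d1 : is_derive x 1 (fun x : R => k * (x - a)) k.
    have d0 : is_derive x 1 (fun x : R => x - a) 1.
      apply: (is_derive_eq (is_deriveB (is_derive_id x 1) (is_derive_cst a x 1))).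
      by rewrite subr0.
    by apply: (is_derive_eq (is_deriveZ k d0)); rewrite scaleRE mulr1.
  apply: (is_derive_eq (@is_derive1_comp _ (flat_exp n) (fun x : R => k * (x - a)) x _ _
    (is_derive_flat_exp n _) d1)).
  by rewrite mulrC mulNr.
- exists (fun x => f' x + g' x); first exact: Flat_add.
  by move=> x; exact: (is_deriveD (df x) (dg x)).
- exists (fun x => c * f' x); first exact: Flat_scale.
  by move=> x; exact: (is_deriveZ c (df x)).
- exists (fun x => f x * g' x + g x * f' x).
    by apply: Flat_add; exact: Flat_mul.
  by move=> x; exact: (is_deriveM (df x) (dg x)).
Qed.

Lemma flat_smooth (R : realType) (f : R -> R) : flat_fun f ->
  forall (n : nat) (s : R), derivable (derive1n n f) s 1.
Proof.
move=> Ff n; suff : flat_fun (derive1n n f).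
  by move=> /flat_is_derive[g _ dg] s; exact: (@ex_derive _ _ _ _ _ _ _ (dg s)).
elim: n => [//|n /flat_is_derive[g Fg dg]] /=.
by rewrite (_ : derive1 _ = g)//; apply/funext => x; rewrite derive1E derive_val.
Qed.

(** [k] is a steepness: on ]a, b[ the value is exp(-1/(k(x-a)) - 1/(k(b-x))), which tends to 1 as
    [k] grows while the support stays. Reflecting by [- k] makes both factors instances of
    [Flat_exp]. *)
Definition bump (R : realType) (k a b x : R) : R :=
  flat_exp 0 (k * (x - a)) * flat_exp 0 ((- k) * (x - b)).

Lemma flat_bump (R : realType) (k a b : R) : flat_fun (bump k a b).
Proof. by apply: Flat_mul; exact: Flat_exp. Qed.

Lemma flat_exp0_ge0 (R : realType) (x : R) : 0 <= flat_exp 0 x.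
Proof. by rewrite /flat_exp; case: ifP => // _; rewrite expr0 mul1r expR_ge0. Qed.

Lemma flat_exp0_le1 (R : realType) (x : R) : flat_exp 0 x <= 1.
Proof.
rewrite /flat_exp; case: ifP => // x0; rewrite expr0 mul1r expR_le1.
by rewrite oppr_le0 invr_ge0 ltW.
Qed.

Lemma bump_ge0 (R : realType) (k a b x : R) : 0 <= bump k a b x.
Proof. by rewrite mulr_ge0 ?flat_exp0_ge0. Qed.

Lemma bump_le1 (R : realType) (k a b x : R) : bump k a b x <= 1.
Proof. by rewrite mulr_ile1 ?flat_exp0_ge0 ?flat_exp0_le1. Qed.

Lemma bump_gt0 (R : realType) (k a b x : R) : 0 < k ->
  (0 < bump k a b x) = (a < x < b).
Proof.
move=> k0; rewrite /bump /flat_exp !expr0 !mul1r mulNr oppr_gt0.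
rewrite (pmulr_rlt0 _ k0) (pmulr_rgt0 _ k0) subr_gt0 subr_lt0.
case: (a < x); rewrite ?mul0r ?ltxx//=.
case: (x < b); rewrite ?mulr0 ?ltxx//.
by rewrite mulr_gt0 ?expR_gt0.
Qed.

Lemma bump_eq0 (R : realType) (k a b x : R) : 0 < k ->
  ~~ (a < x < b) -> bump k a b x = 0.
Proof.
move=> k0; rewrite -(bump_gt0 _ _ _ k0) lt_neqAle bump_ge0 andbT negbK.
by move/eqP.
Qed.

Lemma test_bump (R : realType) (L k a b : R) : 0 < k -> 0 < a -> b < L ->
  test_function L (bump k a b).
Proof.
move=> k0 a0 bL; split; first exact/flat_smooth/flat_bump.
apply: (@subset_trans _ `[a, b]).
  rewrite closureE; apply: smallest_sub; first exact: itv_closed.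
  move=> x /= h; have /andP[ax xb] : a < x < b.
    by apply: contraNT h => /(bump_eq0 k0)->.
  by rewrite in_itv/= !ltW.
by apply: subset_itv; rewrite bnd_simp.
Qed.

Lemma test_derive1 (R : realType) (L : R) (phi : R -> R) :
  test_function L phi -> test_function L (derive1 phi).
Proof.
move=> [sm supp]; split; first by move=> n s; rewrite -derive1Sn.
apply: subset_trans supp; rewrite [X in X `<=` _]closureE.
apply: smallest_sub; first exact: closed_closure.
move=> x /= h; apply: contrapT => /= xn; move/eqP : h; apply.
have : \near x, phi x = 0.
  have : open (~` closure [set s | phi s != 0]) by rewrite openC; exact: closed_closure.
  rewrite openE => /(_ x xn); apply: filterS => y /= yn.
  by apply/eqP; apply: contrapT => /negP h; apply: yn; exact: subset_closure.
move=> nx; rewrite derive1E.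
by rewrite (@near_eq_derive _ _ _ phi (cst 0))// derive_cst.
Qed.

Lemma test_is_derive (R : realType) (L : R) (phi : R -> R) :
  test_function L phi -> forall x : R, is_derive x 1 phi (derive1 phi x).
Proof.
by move=> [sm _] x; apply: DeriveDef; [exact: (sm 0%N)|rewrite derive1E].
Qed.

Lemma test_continuous (R : realType) (L : R) (phi : R -> R) :
  test_function L phi -> continuous phi.
Proof.
by move=> [sm _] x; apply/differentiable_continuous/derivable1_diffP/(sm 0%N).
Qed.

Lemma test_eq0 (R : realType) (L : R) (phi : R -> R) (x : R) :
  test_function L phi -> x \notin `]0, L[ -> phi x = 0.
Proof.
move=> [_ supp] xn; apply/eqP/negPn/negP => h; move/negP : xn; apply.
by apply: supp; exact: subset_closure.
Qed.

Lemma bump_cvg (R : realType) (a b x : R) : a < x < b ->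
  bump n.+1%:R a b x @[n --> \oo] --> (1 : R).
Proof.
move=> /andP[ax xb].
have H (c : R) : 0 < c -> flat_exp 0 (n.+1%:R * c) @[n --> \oo] --> (1 : R).
  move=> c0; have e1 : expR (- (c^-1 * 0)) = 1 :> R by rewrite mulr0 oppr0 expR0.
  rewrite -[X in _ --> X]e1.
  have -> : (fun n : nat => flat_exp 0 (n.+1%:R * c)) =
            (fun n : nat => expR (- (c^-1 * n.+1%:R^-1))).
    apply/funext => n; rewrite /flat_exp (pmulr_rgt0 c (ltr0Sn R n)) c0 expr0 mul1r.
    by rewrite invfM mulrC.
  apply: (@continuous_cvg _ _ _ _ _ (fun n => - (c^-1 * n.+1%:R^-1)) expR).
    exact: continuous_expR.
  by apply: cvgN; apply: cvgZl_tmp; exact: cvg_harmonic.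
rewrite -[X in _ --> X]mulr1; apply: cvgM; first by apply: H; rewrite subr_gt0.
under eq_fun do rewrite mulNr -mulrN opprB.
by apply: H; rewrite subr_gt0.
Qed.

(** * The fundamental lemma of the calculus of variations *)

Section fundamental_lemma.
Context {R : realType}.
Notation mu := (@lebesgue_measure R).
Implicit Types (L a b x : R) (g h phi : R -> R).

Definition bump_orthogonal L g := forall k a b, 0 < k -> 0 < a -> b < L ->
  \int[mu]_(s in `]0, L[) (g s * bump k a b s) = 0.

(* [bump n a b] tends to the indicator of ]a, b[ and is bounded by 1, so the
   dominated convergence theorem applies. *)
Lemma fundamental_lemma_itv L g a b :
  mu.-integrable `]0, L[ (EFin \o g) -> 0 < a -> b < L ->
  bump_orthogonal L g ->
  \int[mu]_(s in `]a, b[) g s = 0.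
Proof.
move=> ig a0 bL H.
have mg : measurable_fun `]0, L[ g by apply/measurable_EFinP; case/integrableP : ig.
have tb n : test_function L (bump n.+1%:R a b) by exact: test_bump.
have mb n : measurable_fun `]0, L[ (bump n.+1%:R a b).
  apply: measurable_funTS; apply: continuous_measurable_fun.
  exact: (test_continuous (tb n)).
have absub : `]a, b[ `<=` `]0, L[.
  by apply: subset_itv; rewrite bnd_simp ltW.
have [] := @dominated_convergence _ _ _ mu `]0, L[%classic (measurable_itv _)
  (fun n s => (g s * bump n.+1%:R a b s)%:E) (EFin \o (g \_ `]a, b[))
  (abse \o (EFin \o g)).
- by move=> n; apply/measurable_EFinP; apply: measurable_funM => //; exact: mb.
- apply/measurable_EFinP/(measurable_restrict _ _ _).1 => //.
  by apply: measurable_funS mg => //; exact: subIsetl.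
- apply: aeW => x _ /=; apply: cvg_EFin; first by apply: nearW.
  suff : g x * bump n.+1%:R a b x @[n --> \oo] --> g x * (if x \in `]a, b[ then 1 else 0).
    by rewrite patchE mem_setE; case: ifPn => _; rewrite ?mulr1 ?mulr0.
  apply: cvgM; first exact: cvg_cst.
  case: ifPn => xab; first by apply: bump_cvg; rewrite in_itv in xab.
  rewrite (_ : (fun n : nat => _) = cst 0); first exact: cvg_cst.
  by apply/funext => n; apply: bump_eq0 => //; rewrite in_itv in xab.
- exact: integrable_abse.
- apply: aeW => x n _ /=; rewrite lee_fin normrM [X in _ * X]ger0_norm ?bump_ge0//.
  by rewrite ler_piMr// bump_le1.
move=> _ _ lim; have := lim; rewrite /Rintegral.
have <- : (\int[mu]_(x in `]0%R, L[) (EFin \o (g \_ `]a, b[)) x =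
         \int[mu]_(x in `]a, b[) (g x)%:E)%E.
  rewrite -[in RHS](setIidr absub) integral_mkcondr; apply: eq_integral => x _ /=.
  by rewrite !patchE; case: ifP.
move=> {}lim.
have fin n : (\int[mu]_(x in `]0%R, L[) (g x * bump n.+1%:R a b x)%:E)%E = 0%E.
  have := H n.+1%:R a b (ltr0Sn R n) a0 bL; rewrite /Rintegral => h.
  rewrite -[LHS]fineK ?h//; apply: integrable_fin_num => //.
  apply: (le_integrable _ _ _ (integrable_abse ig)) => //.
    by apply/measurable_EFinP; apply: measurable_funM => //; exact: mb.
  move=> x _ /=; rewrite lee_fin (normrM (g x)) normr_id.
  rewrite [X in _ * X]ger0_norm ?bump_ge0//.
  by rewrite ler_piMr// bump_le1.
move: lim; under eq_fun do rewrite fin.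
move=> /(cvg_lim (@ereal_hausdorff R)) <-.
by rewrite lim_cst.
Qed.

(** The integral of g from x / 2 to y vanishes for all y near x, so its derivative at x is 0; at a
    Lebesgue point this derivative is g x. Starting at x / 2 keeps the interval away from 0, as the
    bumps require. *)
Lemma fundamental_lemma_pt L g x :
  mu.-integrable `]0, L[ (EFin \o g) ->
  bump_orthogonal L g ->
  x \in `]0, L[ -> lebesgue_pt g x -> g x = 0.
Proof.
move=> ig H; rewrite in_itv/= => /andP[x0 xL] gx.
have xu : x < (x + L) / 2 by lra.
have int2 u : u < L -> mu.-integrable `](x / 2), u] (EFin \o g).
  move=> uL; apply: integrableS ig => //; apply: subset_itv; rewrite bnd_simp//.
  lra.
have [||_ <-] := @FTC1_lebesgue_pt _ g (BRight (x / 2)) x ((x + L) / 2) xu _ _ gx.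
- by apply: int2; lra.
- by rewrite lte_fin; lra.
rewrite derive1E (@near_eq_derive _ _ _ _ (cst 0)) ?derive_cst//.
have : \near x, x < L by exact: lt_nbhsl.
apply: filterS => y yL; rewrite -Rintegral_itv_bndo_bndc; last first.
  apply: integrableS (int2 y yL) => //.
  by apply: subset_itvl; rewrite bnd_simp.
by apply: (fundamental_lemma_itv ig) => //; lra.
Qed.

Lemma fundamental_lemma_ae L g :
  mu.-integrable `]0, L[ (EFin \o g) ->
  bump_orthogonal L g ->
  {ae mu, forall x, x \in `]0, L[ -> g x = 0}.
Proof.
move=> ig H.
have := lebesgue_differentiation (integrable_locally (measurable_itv `]0, L[) ig).
apply: filterS; first exact: (ae_filter_ringOfSetsType mu).
move=> x gx xL.
have xL' : x \in `]0, L[%classic by rewrite mem_setE.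
have <- : (g \_ `]0, L[) x = g x by rewrite patchE xL'.
apply: (@fundamental_lemma_pt L) => //.
  rewrite -restrict_EFin; apply/integrable_restrict => //.
  by rewrite setIid.
move=> k a b k0 a0 bL; rewrite -[RHS](H k a b k0 a0 bL); apply: eq_Rintegral => s sL.
by rewrite patchE sL.
Qed.

Lemma within_continuous_eq0 L g : 0 < L ->
  {within `[0, L], continuous g} -> (forall x, x \in `]0, L[ -> g x = 0) ->
  forall x, x \in `[0, L] -> g x = 0.
Proof.
move=> L0 /(continuous_within_itvP _ L0)[cg g0 gL] H x.
rewrite in_itv/= => /andP[x0 xL].
have [->|x0'] := eqVneq x 0.
  have : g y @[y --> 0^'+] --> 0.
    have : (cst 0 : R -> R) y @[y --> (0:R)^'+] --> 0 by exact: cvg_cst.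
    apply: cvg_trans; apply: near_eq_cvg; near=> y; rewrite H// in_itv/=.
    by apply/andP; split; near: y; [exact: nbhs_right_gt|exact: nbhs_right_lt].
  by move=> h; exact: (cvg_unique _ g0 h).
have [->|xL'] := eqVneq x L.
  have : g y @[y --> L^'-] --> 0.
    have : (cst 0 : R -> R) y @[y --> L^'-] --> 0 by exact: cvg_cst.
    apply: cvg_trans; apply: near_eq_cvg; near=> y; rewrite H// in_itv/=.
    by apply/andP; split; near: y; [exact: nbhs_left_gt|exact: nbhs_left_lt].
  by move=> h; exact: (cvg_unique _ gL h).
by apply: H; rewrite in_itv/= !lt_neqAle x0 xL xL' eq_sym x0'.
Unshelve. all: by end_near. Qed.

(** A continuity point is a Lebesgue point, so no null set is lost inside; the endpoints follow by
    one-sided limits. *)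
Lemma fundamental_lemma_continuous L g : 0 < L ->
  {within `[0, L], continuous g} ->
  bump_orthogonal L g ->
  forall x, x \in `[0, L] -> g x = 0.
Proof.
move=> L0 cg H; apply: within_continuous_eq0 => // x xL.
have ig : mu.-integrable `]0, L[ (EFin \o g).
  apply: (@integrableS _ _ _ mu `[0, L]) => //.
    by apply: subset_itv; rewrite bnd_simp.
  by apply: continuous_compact_integrable => //; exact: segment_compact.
apply: (fundamental_lemma_pt ig) => //.
have [cg' _ _] := (continuous_within_itvP _ L0).1 cg.
apply: (@continuous_lebesgue_pt _ _ _ `]0, L[%classic) => //.
- by apply/measurable_EFinP; case/integrableP : ig.
- exact: cg'.
Qed.

End fundamental_lemma.

(** * Primitives of integrable functions *)

Section primitives.
Context {R : realType}.
Notation mu := (@lebesgue_measure R).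
Implicit Types (L a b x : R) (g h phi u v : R -> R).

Lemma integrable_scale (D : set R) c g : measurable D ->
  mu.-integrable D (EFin \o g) -> mu.-integrable D (EFin \o (fun x => c * g x)).
Proof.
move=> mD ig; have -> : EFin \o (fun x => c * g x) = (fun x => c%:E * (EFin \o g) x)%E.
  by apply/funext => x /=; rewrite EFinM.
exact: integrableZl.
Qed.

Lemma integrable_add (D : set R) f g : measurable D ->
  mu.-integrable D (EFin \o f) -> mu.-integrable D (EFin \o g) ->
  mu.-integrable D (EFin \o (fun x => f x + g x)).
Proof.
move=> mD jf jg.
have -> : EFin \o (fun x => f x + g x) = ((EFin \o f) \+ (EFin \o g))%E.
  by apply/funext => x /=; rewrite EFinD.
exact: integrableD.
Qed.

Lemma integrable_itv_oo_cc L g : mu.-integrable `]0, L[ (EFin \o g) ->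
  mu.-integrable `[0, L] (EFin \o g).
Proof.
move=> /integrableP[/measurable_EFinP mg fg].
have mg' := measurable_fun_itv_cc mg.
apply/integrableP; split; first exact/measurable_EFinP.
rewrite integral_itv_bndoo//.
by apply: measurableT_comp => //; exact/measurable_EFinP.
Qed.

Lemma Rintegral_itv_oo_cc L g : mu.-integrable `]0, L[ (EFin \o g) ->
  \int[mu]_(x in `]0, L[) g x = \int[mu]_(x in `[0, L]) g x.
Proof.
move=> ig; rewrite /Rintegral; congr fine; rewrite [RHS]integral_itv_bndoo//.
by case/integrableP : ig.
Qed.

Lemma integrable_mul_continuous L g u : mu.-integrable `[0, L] (EFin \o g) ->
  {within `[0, L], continuous u} ->
  mu.-integrable `[0, L] (EFin \o (fun x => g x * u x)).
Proof.
move=> ig cu.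
have mg : measurable_fun `[0, L] g by apply/measurable_EFinP; case/integrableP : ig.
have mu' : measurable_fun `[0, L] u.
  by apply: subspace_continuous_measurable_fun.
have [M [_ HM]] := compact_bounded (continuous_compact cu (@segment_compact R 0 L)).
have {HM}bM x : x \in `[0, L] -> `|u x| <= `|M| + 1.
  move=> xL; apply: HM; last by exists x.
  by rewrite (le_lt_trans (ler_norm _))// ltrDl.
apply: (@le_integrable _ _ _ mu _ _ _ (fun x => ((`|M| + 1) * g x)%:E)) => //.
- by apply/measurable_EFinP; exact: measurable_funM.
- move=> x xL /=; rewrite lee_fin !normrM mulrC ler_wpM2r//.
  by rewrite [leRHS]ger0_norm ?addr_ge0// bM.
- exact: integrable_scale.
Qed.

(** Both sides integrate f x g y over the triangle y <= x. This exchange replaces the product rule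
    for functions whose derivative is only integrable. *)
Lemma Fubini_triangle L f g :
  mu.-integrable `[0, L] (EFin \o f) -> mu.-integrable `[0, L] (EFin \o g) ->
  \int[mu]_(x in `[0, L]) (f x * \int[mu]_(y in `[0, x]) g y) =
  \int[mu]_(y in `[0, L]) (g y * \int[mu]_(x in `[y, L]) f x).
Proof.
move=> jf jg.
pose f0 := f \_ `[0, L]; pose g0 := g \_ `[0, L].
have if0 : mu.-integrable setT (EFin \o f0).
  by move: jf; rewrite integrable_mkcond//= (restrict_EFin f).
have ig0 : mu.-integrable setT (EFin \o g0).
  by move: jg; rewrite integrable_mkcond//= (restrict_EFin g).
have mf0 : measurable_fun setT f0 by apply/measurable_EFinP; case/integrableP : if0.
have mg0 : measurable_fun setT g0 by apply/measurable_EFinP; case/integrableP : ig0.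
pose h (z : measurableTypeR R * measurableTypeR R) : R :=
  f0 z.1 * g0 z.2 * (if z.2 <= z.1 then 1 else 0).
have mh : measurable_fun setT h.
  apply: measurable_funM.
    apply: measurable_funM; first by apply: (measurableT_comp mf0).
    by apply: (measurableT_comp mg0).
  apply: measurable_fun_ifT => //.
  by apply: measurable_fun_ler; [exact: measurable_snd|exact: measurable_fst].
(* Integrability on the product follows by Tonelli from |h (x, y)| <= |f0 x| |g0 y|, whose iterated
   integral is a product of two finite ones. *)
have ih : (mu \x mu)%E.-integrable setT (EFin \o h).
  apply/integrable12ltyP; first exact/measurable_EFinP.
  pose K := (\int[mu]_y `|(g0 y)%:E|)%E.
  have Kfin : (K < +oo)%E by case/integrableP : ig0.
  have K0 : (0 <= K)%E by exact: integral_ge0.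
  have le1 x : (\int[mu]_y `|(EFin \o h) (x, y)| <= `|(f0 x)%:E| * K)%E.
    rewrite -ge0_integralZl//; last first.
      by apply: measurableT_comp => //; exact/measurable_EFinP.
    apply: ge0_le_integral => //.
    - apply: measurableT_comp => //; apply/measurable_EFinP.
      exact: (measurableT_comp mh (measurable_pair1 x)).
    - apply: measurable_funeM.
      by apply: measurableT_comp => //; exact/measurable_EFinP.
    - move=> y _ /=; rewrite -EFinM lee_fin /h/= !normrM.
      by case: ifP; rewrite ?normr1 ?normr0 ?mulr1 ?mulr0// mulr_ge0.
  apply: (@le_lt_trans _ _ (\int[mu]_x (`|(f0 x)%:E| * K))%E).
    apply: ge0_le_integral => //.
    - by move=> x _; apply: integral_ge0.
    - apply: (measurable_fun_fubini_tonelli_F (abse \o (EFin \o h))) => //=.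
      by apply: measurableT_comp => //; exact/measurable_EFinP.
    - apply: emeasurable_funM => //.
      by apply: measurableT_comp => //; exact/measurable_EFinP.
  rewrite ge0_integralZr//; last first.
    by apply: measurableT_comp => //; exact/measurable_EFinP.
  rewrite lte_mul_pinfty//.
  - exact: integral_ge0.
  - by rewrite ge0_fin_numE ?integral_ge0//; case/integrableP : if0.
have := Fubini ih.
have intS (a b : R) (k : R -> R) : 0 <= a -> b <= L ->
    mu.-integrable `[0, L] (EFin \o k) -> mu.-integrable `[a, b] (EFin \o k).
  by move=> a0 bL ik; apply: integrableS ik => //; apply: subset_itv; rewrite bnd_simp.
have inner1 x : (\int[mu]_y (EFin \o h) (x, y) =
    (((fun x => f x * \int[mu]_(y in `[0, x]) g y) \_ `[0, L]) x)%:E)%E.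
  rewrite patchE mem_setE; case: ifPn => xL; last first.
    apply: integral0_eq => y _ /=; rewrite /h/= /f0 patchE mem_setE (negbTE xL).
    by rewrite !mul0r.
  have ix : mu.-integrable `[0, x] (EFin \o g).
    by apply: intS => //; move: xL; rewrite in_itv/= => /andP[].
  rewrite EFinM /Rintegral fineK; last exact: integrable_fin_num.
  rewrite -integralZl// [RHS]integral_mkcond; apply: eq_integral => y _ /=.
  rewrite /h/= /f0 /g0 !patchE !mem_setE xL.
  move: xL; rewrite !in_itv/= => /andP[x0 xL].
  case: (leP 0 y) => y0 /=; last by rewrite mulr0 mul0r.
  case: (leP y x) => yx; last by rewrite mulr0.
  by rewrite (le_trans yx xL) mulr1.
have inner2 y : (\int[mu]_x (EFin \o h) (x, y) =
    (((fun y => g y * \int[mu]_(x in `[y, L]) f x) \_ `[0, L]) y)%:E)%E.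
  rewrite patchE mem_setE; case: ifPn => yL; last first.
    apply: integral0_eq => x _ /=; rewrite /h/= /g0 !patchE !mem_setE (negbTE yL).
    by rewrite mulr0 !mul0r.
  have ix : mu.-integrable `[y, L] (EFin \o f).
    by apply: intS => //; move: yL; rewrite in_itv/= => /andP[].
  rewrite EFinM /Rintegral fineK; last exact: integrable_fin_num.
  rewrite -integralZl// [RHS]integral_mkcond; apply: eq_integral => x _ /=.
  rewrite /h/= /f0 /g0 !patchE !mem_setE yL.
  move: yL; rewrite !in_itv/= => /andP[y0 yL].
  case: (leP y x) => yx; last by rewrite mulr0.
  by rewrite (le_trans y0 yx) /=; case: ifP; rewrite ?mulr1 ?mul0r// mulrC.
under eq_integral do rewrite inner1.
under [X in _ = X]eq_integral do rewrite inner2.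
move=> FE; rewrite [LHS]Rintegral_mkcond [RHS]Rintegral_mkcond.
by congr fine; exact: FE.
Qed.

(** Absolute continuity in integral form: it asks for no pointwise derivative, which suits a g known
    only almost everywhere. *)
Definition primitive L u g := mu.-integrable `[0, L] (EFin \o g) /\
  forall x, x \in `[0, L] -> u x = u 0 + \int[mu]_(y in `[0, x]) g y.

Lemma primitive_continuous L u g : 0 < L -> primitive L u g ->
  {within `[0, L], continuous u}.
Proof.
move=> L0 [ig ug].
have := parameterized_integral_continuous (ltW L0) ig.
move=> /subspace_continuousP H; apply/subspace_continuousP => x xL.
have e y : y \in `[0, L] -> u 0 + parameterized_integral mu 0 y g = u y.
  by move=> yL; rewrite (ug _ yL).
have -> : from_subspace `[0, L] u x = u 0 + parameterized_integral mu 0 x g by rewrite e.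
apply: (@cvg_trans _
  ((fun y => u 0 + parameterized_integral mu 0 y g) @ within `[0, L] (nbhs x))).
  apply: near_eq_cvg; rewrite near_withinE; apply: nearW => y yL; exact: e.
by apply: cvgD; [exact: cvg_cst|exact: H].
Qed.

(** Writing v as v 0 plus the integral of g leaves a double integral; once the order is exchanged,
    the inner integral of f over [x, L] is u L - u x. *)
Lemma primitive_by_parts L u v f g : 0 < L -> primitive L u f -> primitive L v g ->
  \int[mu]_(x in `[0, L]) (f x * v x) + \int[mu]_(x in `[0, L]) (g x * u x) =
  u L * v L - u 0 * v 0.
Proof.
move=> L0 puf pvg; have cu := primitive_continuous L0 puf.
have cv := primitive_continuous L0 pvg; case: puf pvg => [jf uf] [jg vg].
have L0L : L \in `[0, L] by rewrite in_itv/= lexx ltW.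
have iS (k : R -> R) (a b : itv_bound R) : (BLeft 0 <= a)%O -> (b <= BRight L)%O ->
    mu.-integrable `[0, L] (EFin \o k) -> mu.-integrable [set` Interval a b] (EFin \o k).
  by move=> a0 bL ik; apply: integrableS ik => //; apply: subset_itv.
have ivx x : x \in `[0, L] -> \int[mu]_(y in `[x, L]) f y = u L - u x.
  move=> xL; have /andP[x0 xL'] : 0 <= x <= L by rewrite in_itv in xL.
  have : \int[mu]_(t in `[0, L]) f t - \int[mu]_(t in `[0, x]) f t =
      \int[mu]_(t in `]x, L]) f t by apply: Rintegral_itvB.
  rewrite -Rintegral_itv_obnd_cbnd; last by apply: iS jf; rewrite bnd_simp.
  by move=> <-; rewrite (uf _ L0L) (uf _ xL); ring.
have E1 : \int[mu]_(x in `[0, L]) (f x * v x) =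
    \int[mu]_(x in `[0, L]) (f x * v 0) +
    \int[mu]_(x in `[0, L]) (f x * \int[mu]_(y in `[0, x]) g y).
  rewrite -RintegralD//.
  - by apply: eq_Rintegral => x; rewrite mem_setE => xL; rewrite (vg _ xL) mulrDr.
  - apply: integrable_mul_continuous => //; apply: continuous_subspaceT.
    exact: cst_continuous.
  - apply: integrable_mul_continuous => //.
    exact: (parameterized_integral_continuous (ltW L0) jg).
have E2 : \int[mu]_(y in `[0, L]) (g y * \int[mu]_(x in `[y, L]) f x) =
    \int[mu]_(x in `[0, L]) (g x * u L) - \int[mu]_(x in `[0, L]) (g x * u x).
  rewrite -RintegralB//.
  - by apply: eq_Rintegral => x; rewrite mem_setE => xL; rewrite ivx// mulrBr.
  - apply: integrable_mul_continuous => //; apply: continuous_subspaceT.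
    exact: cst_continuous.
  - exact: integrable_mul_continuous.
rewrite E1 Fubini_triangle// E2 !RintegralZr// addrA subrK.
have -> : \int[mu]_(x in `[0, L]) f x = u L - u 0 by rewrite (uf _ L0L); ring.
have -> : \int[mu]_(x in `[0, L]) g x = v L - v 0 by rewrite (vg _ L0L); ring.
ring.
Qed.

Lemma derive_primitive L u g : 0 < L -> continuous g ->
  (forall x : R, is_derive x 1 u (g x)) -> primitive L u g.
Proof.
move=> L0 cg du.
have cg' a b : {within `[a, b], continuous g} by exact: continuous_subspaceT.
have ig a b : mu.-integrable `[a, b] (EFin \o g).
  by apply: continuous_compact_integrable => //; exact: segment_compact.
have dru x : derivable u x 1 by exact: (@ex_derive _ _ _ _ _ _ _ (du x)).
have cu : continuous u by move=> x; exact/differentiable_continuous/derivable1_diffP.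
split => // x; rewrite in_itv/= => /andP[x0 xL].
have [->|xn0] := eqVneq x 0; first by rewrite set_itv1 Rintegral_set1 addr0.
have {}x0 : 0 < x by rewrite lt_neqAle eq_sym xn0.
rewrite /Rintegral (continuous_FTC2 x0 (cg' _ _) (F := u)) //=.
- by ring.
- split => //.
  + by apply: cvg_at_right_filter; exact: cu.
  + by apply: cvg_at_left_filter; exact: cu.
- by move=> y _; rewrite derive1E; exact: (@derive_val _ _ _ _ _ _ _ (du y)).
Qed.

End primitives.

(** * Weak derivatives and primitives *)

Section weak_derivatives.
Context {R : realType}.
Notation mu := (@lebesgue_measure R).
Implicit Types (L a b x : R) (g h phi u v : R -> R).

Definition scalar_weak_derivative L u g := forall phi, test_function L phi ->
  \int[mu]_(s in `]0, L[) (u s * derive1 phi s) =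
  - \int[mu]_(s in `]0, L[) (g s * phi s).

Lemma Rintegral_itv_cc_oo L g : mu.-integrable `[0, L] (EFin \o g) ->
  \int[mu]_(x in `]0, L[) g x = \int[mu]_(x in `[0, L]) g x.
Proof.
move=> ig; apply: Rintegral_itv_oo_cc; apply: integrableS ig => //.
by apply: subset_itv; rewrite bnd_simp.
Qed.

Lemma within_continuous_integrable L u : {within `[0, L], continuous u} ->
  mu.-integrable `[0, L] (EFin \o u).
Proof.
by move=> cu; apply: continuous_compact_integrable => //; exact: segment_compact.
Qed.

Lemma primitive_scalar_weak_derivative L u g : 0 < L -> primitive L u g ->
  scalar_weak_derivative L u g.
Proof.
move=> L0 pug phi tphi.
have cphi' := test_continuous (test_derive1 tphi).
have pphi := derive_primitive L0 cphi' (test_is_derive tphi).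
have cu := primitive_continuous L0 pug.
have cphi := primitive_continuous L0 pphi.
have phi0 : phi 0 = 0 by apply: (test_eq0 tphi); rewrite in_itv/= ltxx.
have phiL : phi L = 0 by apply: (test_eq0 tphi); rewrite in_itv/= ltxx andbF.
have := primitive_by_parts L0 pug pphi.
rewrite phi0 phiL !mulr0 subrr => /eqP; rewrite addrC addr_eq0 => /eqP E.
rewrite !Rintegral_itv_cc_oo.
- by rewrite -E; apply: eq_Rintegral => x _; rewrite mulrC.
- by apply: integrable_mul_continuous => //; case: pug.
- apply: integrable_mul_continuous => //; last exact: continuous_subspaceT.
  exact: within_continuous_integrable.
Qed.

(** If the integral were 0, nonnegativity would make the integral over [0, y] vanish for y near x,
    but its derivative at x is g x. This makes the mass of the reference bump [psi0] positive. *)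
Lemma continuous_ge0_Rintegral_gt0 L g x : continuous g -> (forall y, 0 <= g y) ->
  x \in `]0, L[ -> 0 < g x -> 0 < \int[mu]_(y in `]0, L[) g y.
Proof.
move=> cg g0; rewrite in_itv/= => /andP[x0 xL] gx.
have ig : mu.-integrable `[0, L] (EFin \o g).
  by apply: within_continuous_integrable; exact: continuous_subspaceT.
have ig' (u : R) : u <= L -> mu.-integrable `[0, u] (EFin \o g).
  by move=> uL; apply: integrableS ig => //; apply: subset_itv; rewrite bnd_simp.
rewrite lt_neqAle Rintegral_ge0 ?andbT; last by [].
apply/eqP => H.
have [] := @continuous_FTC1_closed _ g 0 x ((x + L) / 2) _ _ x0 (cg x).
- by lra.
- by apply: ig'; lra.
move=> _; rewrite derive1E (@near_eq_derive _ _ _ _ (cst 0)) ?derive_cst//.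
  by move=> gx0; rewrite -gx0 ltxx in gx.
have : \near x, x < L by exact: lt_nbhsl.
apply: filterS => y yL; apply/eqP; rewrite eq_le Rintegral_ge0 ?andbT; last by [].
have [y0|y0] := leP 0 y; last first.
  by rewrite set_itv_ge ?bnd_simp -?ltNge// Rintegral_set0.
have := @Rintegral_itvB _ g (BLeft 0) (BRight L) y ig.
rewrite Rintegral_itv_cc_oo// in H.
rewrite -H => /(_ _ _)/eqP; rewrite sub0r !bnd_simp (ltW yL) => /(_ y0 isT).
by rewrite eqr_oppLR => /eqP ->; rewrite oppr_le0 Rintegral_ge0.
Qed.

(* A bump minus the multiple of [psi0] with the same mass is the derivative of
   a test function, hence is orthogonal to [h]; so [h - c] is orthogonal to all
   bumps, where [c] is the mean of [h] against [psi0]. *)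
Lemma scalar_weak_derivative0_cst L h : 0 < L ->
  {within `[0, L], continuous h} ->
  (forall phi, test_function L phi ->
    \int[mu]_(s in `]0, L[) (h s * derive1 phi s) = 0) ->
  exists c, forall x, x \in `[0, L] -> h x = c.
Proof.
move=> L0 ch H.
pose psi0 : R -> R := bump 1 (L / 3) (L - L / 3).
have cpsi k a b : continuous (bump k a b : R -> R).
  have [g _ dg] := flat_is_derive (flat_bump k a b).
  move=> x; apply/differentiable_continuous/derivable1_diffP.
  exact: (@ex_derive _ _ _ _ _ _ _ (dg x)).
pose m := \int[mu]_(s in `]0, L[) psi0 s.
have m0 : 0 < m.
  apply: (@continuous_ge0_Rintegral_gt0 _ _ (L / 2)).
  - exact: cpsi.
  - by move=> y; exact: bump_ge0.
  - by rewrite in_itv/=; apply/andP; split; lra.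
  - by rewrite bump_gt0//; apply/andP; split; lra.
have ib k a b : mu.-integrable `[0, L] (EFin \o (bump k a b : R -> R)).
  by apply: within_continuous_integrable; exact: continuous_subspaceT.
have ihb k a b : mu.-integrable `[0, L] (EFin \o (fun s => h s * bump k a b s)).
  apply: integrable_mul_continuous; first exact: within_continuous_integrable.
  exact: continuous_subspaceT.
have S01 : `]0, L[ `<=` `[0, L] by apply: subset_itv; rewrite bnd_simp.
have ib' k a b : mu.-integrable `]0, L[ (EFin \o (bump k a b : R -> R)).
  exact: (@integrableS _ _ _ mu `[0, L]).
have ihb' k a b : mu.-integrable `]0, L[ (EFin \o (fun s => h s * bump k a b s)).
  exact: (@integrableS _ _ _ mu `[0, L]).
exists (\int[mu]_(s in `]0, L[) (h s * psi0 s) / m) => x xL.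
set c := _ / m.
apply/eqP; rewrite -subr_eq0; apply/eqP.
apply: (@fundamental_lemma_continuous _ L (fun s => h s - c)) => //.
  have cc : {within `[0, L], continuous (cst c : R -> R)}.
    exact: continuous_subspaceT (@cst_continuous _ _ _).
  by move=> y; apply: cvgB; [exact: ch|exact: cc].
move=> k a b k0 a0 bL.
pose d := \int[mu]_(s in `]0, L[) bump k a b s / m.
pose psi s := bump k a b s + (- d) * psi0 s.
have Fpsi : flat_fun psi.
  by apply: Flat_add; [exact: flat_bump|apply: Flat_scale; exact: flat_bump].
have cp : continuous psi.
  have [g _ dg] := flat_is_derive Fpsi.
  move=> y; apply/differentiable_continuous/derivable1_diffP.
  exact: (@ex_derive _ _ _ _ _ _ _ (dg y)).
(* An interval compactly inside ]0, L[ that contains the supports of both bumps. *)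
pose a' := Num.min a (L / 3); pose b' := Num.max b (L - L / 3).
have a'0 : 0 < a' by rewrite lt_min a0; lra.
have b'L : b' < L by rewrite gt_max bL; lra.
have psi_out s : ~~ (a' < s < b') -> psi s = 0.
  move=> sab; rewrite /psi /psi0 !bump_eq0 ?mulr0 ?addr0//.
  - apply: contra sab => /andP[s1 s2].
    by rewrite /a' /b' gt_min lt_max s1 s2 ?orbT.
  - apply: contra sab => /andP[s1 s2].
    by rewrite /a' /b' gt_min lt_max s1 s2 ?orbT.
have int_psi : \int[mu]_(s in `]0, L[) psi s = 0.
  rewrite /psi RintegralD//; last first.
    by apply: integrable_scale => //; exact: ib'.
  by rewrite RintegralZl//; [rewrite mulNr -/m divfK ?subrr// gt_eqF|exact: ib'].
have ipsi : mu.-integrable setT (EFin \o psi).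
  have -> : psi = psi \_ `[0, L].
    apply/funext => s; rewrite patchE mem_setE in_itv/=; case: ifPn => // sL.
    apply: psi_out; apply: contra sL => /andP[s1 s2].
    by rewrite (ltW (lt_trans a'0 s1)) (ltW (lt_trans s2 b'L)).
  rewrite -restrict_EFin -integrable_mkcond//.
  by apply: within_continuous_integrable; exact: continuous_subspaceT.
pose phi y := \int[mu]_(s in `]-oo, y]) psi s.
have dphi y : derivable phi y 1 /\ derive1 phi y = psi y.
  apply: (@continuous_FTC1 _ _ _ _ (y + 1)) => //; first by rewrite ltrDl.
  - exact: integrableS ipsi.
  - by rewrite ltNyr.
  - exact: cp.
have phiE : derive1 phi = psi by apply/funext => y; case: (dphi y).
have tphi : test_function L phi.
  split.
    case => [|n] s; first by case: (dphi s).
    by rewrite derive1Sn phiE; exact: flat_smooth.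
  (* Left of a' the integrand is 0; right of b' the integral is already the whole mass of [psi],
     which is 0 by the choice of [d]. *)
  apply: (@subset_trans _ `[a', b']); last first.
    by apply: subset_itv; rewrite bnd_simp.
  rewrite closureE; apply: smallest_sub; first exact: itv_closed.
  move=> y /= phiy; apply: contrapT => yab; move/eqP : phiy; apply.
  move: yab; rewrite in_itv/= => /negP; rewrite negb_and -!ltNge => /orP[ya|yb].
    rewrite /phi; under eq_Rintegral => s.
      rewrite mem_setE in_itv/= => sy.
      rewrite psi_out; last by rewrite negb_and -leNgt (le_trans sy (ltW ya)).
      over.
    by rewrite Rintegral_cst// mul0r.
  rewrite -int_psi /phi Rintegral_mkcond [RHS]Rintegral_mkcond; congr Rintegral.
  apply/funext => s; rewrite !patchE !mem_setE !in_itv/=.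
  have [sab|sab] := boolP (a' < s < b'); last by rewrite psi_out//; do 2 case: ifP.
  have /andP[s1 s2] := sab.
  by rewrite (ltW (lt_trans s2 yb)) (lt_trans a'0 s1) (lt_trans s2 b'L).
have := H _ tphi; rewrite phiE => H1.
have H2 : \int[mu]_(s in `]0, L[) (h s * bump k a b s) =
    d * \int[mu]_(s in `]0, L[) (h s * psi0 s).
  rewrite -RintegralZl//; last exact: ihb'.
  apply/eqP; rewrite -subr_eq0 -RintegralB//; first last.
    by apply: integrable_scale => //; exact: ihb'.
  apply/eqP; apply: etrans H1; apply: eq_Rintegral => s _; rewrite /psi; ring.
under eq_Rintegral do rewrite mulrBl.
rewrite RintegralB//; last first.
  exact: integrable_scale.
rewrite RintegralZl// H2 /c /d; ring.
Qed.

(** The primitive [U] of g has the same weak derivative as u, so u - U is constant by the du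
    Bois-Reymond lemma just proved. *)
Lemma weak_derivative_primitive L u g : 0 < L -> {within `[0, L], continuous u} ->
  mu.-integrable `[0, L] (EFin \o g) -> scalar_weak_derivative L u g ->
  primitive L u g.
Proof.
move=> L0 cu ig wu.
pose U x := \int[mu]_(y in `[0, x]) g y.
have U0 : U 0 = 0 by rewrite /U set_itv1 Rintegral_set1.
have pU : primitive L U g by split=> // x _; rewrite U0 add0r.
have cU := primitive_continuous L0 pU.
have wU := primitive_scalar_weak_derivative L0 pU.
have [||c Hc] := @scalar_weak_derivative0_cst L (fun x => u x - U x) L0.
- by move=> y; apply: cvgB; [exact: cu|exact: cU].
- move=> phi tphi; under eq_Rintegral do rewrite mulrBl.
  have cphi' := test_continuous (test_derive1 tphi).
  have ii v : {within `[0, L], continuous v} ->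
      mu.-integrable `]0, L[ (EFin \o (fun s => v s * derive1 phi s)).
    move=> cv; apply: (@integrableS _ _ _ mu `[0, L]) => //.
      by apply: subset_itv; rewrite bnd_simp.
    apply: integrable_mul_continuous; first exact: within_continuous_integrable.
    exact: continuous_subspaceT.
  by rewrite RintegralB//; [rewrite wu// wU// subrr|exact: ii|exact: ii].
split=> // x xL; have := Hc _ xL; rewrite -(Hc 0).
  by rewrite U0 subr0 => <-; rewrite -/(U x) subrK.
by rewrite in_itv/= lexx ltW.
Qed.

End weak_derivatives.

(** * The Hardy-Littlewood inequality *)

Section hardy_littlewood.
Context {R : realType}.
Notation mu := (@lebesgue_measure R).

Lemma hardy_littlewood (L a : R) (u u1 u2 : R -> R) : 0 < L -> 0 < a ->
  primitive L u u1 -> primitive L u1 u2 -> u L = 0 -> u1 L = 0 ->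
  mu.-integrable `[0, L] (EFin \o (fun x => u2 x * u2 x)) ->
  \int[mu]_(x in `[0, L]) (u1 x * u1 x) <=
  a ^+ 2 * \int[mu]_(x in `[0, L]) (u2 x * u2 x) +
  a ^- 2 * \int[mu]_(x in `[0, L]) (u x * u x).
Proof.
move=> L0 a0 pu pu1 uL u1L i22.
have cu := primitive_continuous L0 pu; have cu1 := primitive_continuous L0 pu1.
have i2 : mu.-integrable `[0, L] (EFin \o u2) by case: pu1.
have i1 := within_continuous_integrable cu1.
have i0 := within_continuous_integrable cu.
have i21 := integrable_mul_continuous i2 cu1.
have i20 := integrable_mul_continuous i2 cu.
have i11 := integrable_mul_continuous i1 cu1.
have i10 := integrable_mul_continuous i1 cu.
have i00 := integrable_mul_continuous i0 cu.
have := primitive_by_parts L0 pu pu; have := primitive_by_parts L0 pu1 pu1.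
have := primitive_by_parts L0 pu pu1; rewrite uL u1L !mul0r !sub0r.
set A := \int[mu]_(x in `[0, L]) (u2 x * u2 x).
set I11 := Rintegral _ _ _; set I20 := Rintegral _ _ _.
set I21 := Rintegral _ _ _; set I10 := Rintegral _ _ _; set I00 := Rintegral _ _ _.
move=> e1 e2 e3.
have : 0 <= \int[mu]_(x in `[0, L]) ((a * u2 x + u1 x + a^-1 * u x) ^+ 2).
  by apply: Rintegral_ge0 => x _; exact: sqr_ge0.
have mI : measurable `[0, L]%classic by exact: measurable_itv.
have -> : \int[mu]_(x in `[0, L]) ((a * u2 x + u1 x + a^-1 * u x) ^+ 2) =
    a ^+ 2 * A + 2 * a * I21 + 2 * I20 + I11 + 2 * a^-1 * I10 + a ^- 2 * I00.
{ rewrite -!RintegralZl// -!RintegralD//.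
  - by apply: eq_Rintegral => x _; field; rewrite gt_eqF.
  all: by repeat (apply: integrable_add => //); exact: integrable_scale. }
move=> H.
have an0 : a != 0 by rewrite gt_eqF.
rewrite -subr_ge0; apply: (le_trans H); rewrite -subr_ge0.
(* As u and u1 vanish at L, boundary terms survive only at 0. The cross term 2 I20 yields -2 I11 and
   so reverses the sign of I11. *)
have -> : I20 = - (u 0 * u1 0) - I11 by rewrite -e1; ring.
have -> : I21 = - (u1 0 * u1 0) / 2 by rewrite -e2; field.
have -> : I10 = - (u 0 * u 0) / 2 by rewrite -e3; field.
(* The boundary terms at 0 assemble into a square of favourable sign. *)
have -> : a ^+ 2 * A + a ^- 2 * I00 - I11 -
    (a ^+ 2 * A + 2 * a * (- (u1 0 * u1 0) / 2) + 2 * (- (u 0 * u1 0) - I11) +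
     I11 + 2 / a * (- (u 0 * u 0) / 2) + a ^- 2 * I00) =
    a * (u1 0 + a^-1 * u 0) ^+ 2 by field.
by rewrite mulr_ge0 ?sqr_ge0 ?ltW.
Qed.

End hardy_littlewood.

(** * Square-integrable functions *)

Section square_integrable.
Context {R : realType}.
Notation mu := (@lebesgue_measure R).
Implicit Types (L : R) (f g u v : R -> R).

Definition sq_integrable L g := measurable_fun `]0, L[ g /\
  mu.-integrable `]0, L[ (EFin \o (fun s => g s * g s)).

Lemma Lfun2P L g : g \_ `]0, L[ \in Lfun mu 2%:E <-> sq_integrable L g.
Proof.
split=> [gL|[mg ig]].
- split.
    move: gL => /[!inE]/andP[/[!inE]/= mg _].
    by apply/(measurable_restrictT _ _).2.
  have /Lfun1_integrable := Lfun2_mul_Lfun1 gL gL.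
  rewrite [X in _ -> X]integrable_mkcond// restrict_EFin.
  congr (_.-integrable _ _); apply/funext => s /=; rewrite !patchE.
  by case: ifP; rewrite ?mul0r.
- have mg' : measurable_fun setT (g \_ `]0, L[).
    by apply/(measurable_restrictT _ _).1.
  rewrite inE; apply/andP; split; rewrite inE//= /finite_norm unlock.
  apply: poweR_lty.
  move: ig; rewrite integrable_mkcond//= restrict_EFin => /integrableP[_].
  apply: le_lt_trans; rewrite le_eqVlt; apply/orP; left; apply/eqP.
  apply: eq_integral => s _ /=; rewrite !patchE.
  case: ifP => _; rewrite powR_mulrn// ?normr0 ?expr0n//.
  by rewrite -normrX expr2.
Qed.

Lemma sq_integrable_mul L f g : sq_integrable L f -> sq_integrable L g ->
  mu.-integrable `]0, L[ (EFin \o (fun s => f s * g s)).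
Proof.
move=> [mf jf] [mg jg].
apply: (@le_integrable _ _ _ mu _ _ _ (EFin \o (fun s => f s * f s + g s * g s))) => //.
- by apply/measurable_EFinP; exact: measurable_funM.
- move=> s _ /=; rewrite lee_fin [leRHS]ger0_norm; last first.
    by rewrite addr_ge0// -expr2 sqr_ge0.
  rewrite ler_norml; apply/andP; split.
    have := sqr_ge0 (f s + g s); have := sqr_ge0 (f s).
    by have := sqr_ge0 (g s); rewrite !expr2; nra.
  have := sqr_ge0 (f s - g s); have := sqr_ge0 (f s).
  by have := sqr_ge0 (g s); rewrite !expr2; nra.
- exact: integrable_add.
Qed.

Lemma sq_integrable_line L t f g : sq_integrable L f -> sq_integrable L g ->
  sq_integrable L (fun s => f s + t * g s).
Proof.
move=> If Ig; have jfg := sq_integrable_mul If Ig.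
case: If Ig => [mf jf] [mg jg]; split.
  by apply: measurable_funD => //; apply: measurable_funM.
have -> : (fun s => (f s + t * g s) * (f s + t * g s)) =
    (fun s => f s * f s + (2 * t * (f s * g s) + t ^+ 2 * (g s * g s))).
  by apply/funext => s; ring.
by do 2 (apply: integrable_add => //); exact: integrable_scale.
Qed.

Lemma continuous_sq_integrable L g : {within `[0, L], continuous g} ->
  sq_integrable L g.
Proof.
move=> cg; have S : `]0, L[ `<=` `[0, L] by apply: subset_itv; rewrite bnd_simp.
have ig := within_continuous_integrable cg.
split; last first.
  by apply: (@integrableS _ _ _ mu `[0, L]) => //; exact: integrable_mul_continuous.
apply: (measurable_funS _ S) => //.
by apply/measurable_EFinP; case/integrableP : ig.
Qed.

Lemma sq_integrable_integrable L g : sq_integrable L g ->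
  mu.-integrable `[0, L] (EFin \o g).
Proof.
move=> Ig; apply: integrable_itv_oo_cc.
have I1 : sq_integrable L (cst 1).
  by apply: continuous_sq_integrable; exact: continuous_subspaceT (@cst_continuous _ _ _).
have := sq_integrable_mul Ig I1.
by congr (_.-integrable _ _); apply/funext => s /=; rewrite mulr1.
Qed.

Lemma primitive_line L t u v f g : primitive L u f -> primitive L v g ->
  primitive L (fun s => u s + t * v s) (fun s => f s + t * g s).
Proof.
move=> [jf uf] [jg vg]; split.
  by apply: integrable_add => //; exact: integrable_scale.
move=> x xL; have S : `[0, x] `<=` `[0, L].
  by move: xL; rewrite in_itv/= => /andP[_ xL]; apply: subset_itv; rewrite bnd_simp.
have jf' : mu.-integrable `[0, x] (EFin \o f) by apply: integrableS jf.
have jg' : mu.-integrable `[0, x] (EFin \o g) by apply: integrableS jg.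
rewrite RintegralD//; last exact: integrable_scale.
by rewrite RintegralZl// (uf _ xL) (vg _ xL); ring.
Qed.

End square_integrable.

(** * The L^2 inner product of vector fields and its expansion along a line *)

Section vector_L2.
Context {R : realType}.
Notation mu := (@lebesgue_measure R).
Implicit Types (L t : R) (u v f g x y : R -> 'rV[R]_3).

Definition component u (i : 'I_3) : R -> R := fun s => u s 0 i.

Lemma L2P L u : L2 L u <-> forall i, sq_integrable L (component u i).
Proof. by split=> H i; exact/Lfun2P/H. Qed.

(** The shape [x s + t *: y s] serves throughout: t = -1 gives differences and a free t gives
    variations, so one set of linearity lemmas covers both. *)
Lemma component_line t x y i :
  component (fun s => x s + t *: y s) i =
  (fun s => component x i s + t * component y i s).
Proof. by apply/funext => s; rewrite /component !mxE. Qed.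

Lemma L2_line L t x y : L2 L x -> L2 L y -> L2 L (fun s => x s + t *: y s).
Proof.
move=> /L2P Ix /L2P Iy; apply/L2P => i; rewrite component_line.
exact: sq_integrable_line.
Qed.

Lemma dotvC (a b : 'rV[R]_3) : dotv a b = dotv b a.
Proof. by apply: eq_bigr => i _; rewrite mulrC. Qed.

Lemma dotv_lineD (a b c : 'rV[R]_3) t : dotv (a + t *: b) c = dotv a c + t * dotv b c.
Proof.
rewrite /dotv mulr_sumr -big_split; apply: eq_bigr => i _.
by rewrite !mxE /=; ring.
Qed.

Lemma dotv_ge0 (a : 'rV[R]_3) : 0 <= dotv a a.
Proof. by apply: sumr_ge0 => i _; rewrite -expr2 sqr_ge0. Qed.

Lemma integrable_dotv L x y : L2 L x -> L2 L y ->
  mu.-integrable `]0, L[ (EFin \o (fun s => dotv (x s) (y s))).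
Proof.
move=> /L2P Ix /L2P Iy.
have -> : EFin \o (fun s => dotv (x s) (y s)) =
    (fun s => \sum_(i < 3) (component x i s * component y i s)%:E)%E.
  by apply/funext => s /=; rewrite /dotv sumEFin.
apply: integrable_sum => // i _; exact: sq_integrable_mul.
Qed.

Lemma L2dotE L x y : L2 L x -> L2 L y ->
  L2dot L x y = \sum_(i < 3) \int[mu]_(s in `]0, L[) (component x i s * component y i s).
Proof.
move=> /L2P Ix /L2P Iy; rewrite /L2dot /dotv.
under eq_Rintegral do rewrite !big_ord_recl big_ord0 addr0.
rewrite !big_ord_recl big_ord0 addr0.
have I i := sq_integrable_mul (Ix i) (Iy i).
rewrite RintegralD//; [|exact: I|apply: integrable_add => //; exact: I].
by rewrite RintegralD//; exact: I.
Qed.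

Lemma L2dotC L x y : L2dot L x y = L2dot L y x.
Proof. by apply: eq_Rintegral => s _; rewrite dotvC. Qed.

Lemma L2dot_line L t x y z : L2 L x -> L2 L y -> L2 L z ->
  L2dot L (fun s => x s + t *: y s) z = L2dot L x z + t * L2dot L y z.
Proof.
move=> Ix Iy Iz; rewrite /L2dot.
under eq_Rintegral do rewrite dotv_lineD.
have jx := integrable_dotv Ix Iz; have jy := integrable_dotv Iy Iz.
rewrite RintegralD//; last exact: integrable_scale.
by rewrite RintegralZl.
Qed.

Lemma L2normsq_line L t x y : L2 L x -> L2 L y ->
  L2normsq L (fun s => x s + t *: y s) =
  L2normsq L x + 2 * t * L2dot L x y + t ^+ 2 * L2normsq L y.
Proof.
move=> Ix Iy; have := L2_line t Ix Iy; set z := fun s => _; move=> Iz.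
have e w : L2 L w -> L2dot L z w = L2dot L x w + t * L2dot L y w.
  exact: L2dot_line.
rewrite /L2normsq (e z Iz) (L2dotC _ x z) (L2dotC _ y z) (e x Ix) (e y Iy).
by rewrite (L2dotC _ y x); ring.
Qed.

Lemma L2normsq_ge0 L x : 0 <= L2normsq L x.
Proof. by apply: Rintegral_ge0 => s _; exact: dotv_ge0. Qed.

(** Expand c |x - y / c|^2 >= 0. The weight [c] stays free, to be tuned to the kinetic term. *)
Lemma L2dot_young L c x y : 0 < c -> L2 L x -> L2 L y ->
  2 * L2dot L x y <= c * L2normsq L x + c^-1 * L2normsq L y.
Proof.
move=> c0 Ix Iy; have := L2normsq_ge0 L (fun s => x s + (- c^-1) *: y s).
rewrite L2normsq_line// => H.
have : 0 <= c * (L2normsq L x + 2 * - c^-1 * L2dot L x y + (- c^-1) ^+ 2 * L2normsq L y).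
  by rewrite mulr_ge0// ltW.
move=> {}H; rewrite -subr_ge0; apply: (le_trans H).
by rewrite le_eqVlt; apply/orP; left; apply/eqP; field; rewrite gt_eqF.
Qed.

Lemma eq_L2normsq L x y : (forall s, s \in `]0, L[ -> x s = y s) ->
  L2normsq L x = L2normsq L y.
Proof. by move=> xy; apply: eq_Rintegral => s; rewrite mem_setE => sL; rewrite xy. Qed.

End vector_L2.

(** * Regularity in H^2 *)

Section H2_regularity.
Context {R : realType}.
Notation mu := (@lebesgue_measure R).
Implicit Types (L t : R) (u v d f g : R -> 'rV[R]_3).

Lemma continuous_componentP L u : {within `[0, L], continuous u} <->
  forall i, {within `[0, L], continuous (component u i)}.
Proof.
split=> [cu i x|cu x].
  apply: (@continuous_cvg _ _ _ _ _ (from_subspace `[0, L] u)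
    (fun M : 'rV[R]_3 => M 0 i)).
    exact: coord_continuous.
  exact: cu.
have -> : u = fun s => \sum_(i < 3) component u i s *: (delta_mx 0 i : 'rV[R]_3).
  by apply/funext => s; rewrite {1}(row_sum_delta (u s)).
rewrite (_ : (fun s => _) = (fun s => component u 0 s *: (delta_mx 0 0 : 'rV[R]_3) +
    (component u 1 s *: (delta_mx 0 1 : 'rV[R]_3) +
     component u (lift 0 (lift 0 0)) s *: (delta_mx 0 (lift 0 (lift 0 0)) : 'rV[R]_3)))).
  by apply: cvgD; [|apply: cvgD]; apply: cvgZr_tmp; exact: cu.
apply/funext => s; rewrite !big_ord_recl big_ord0 addr0.
by rewrite (_ : lift 0 0 = 1 :> 'I_3)//; exact/val_inj.
Qed.

Lemma weak_derivativeP L u g : weak_derivative L u g <->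
  L2 L g /\ forall i, scalar_weak_derivative L (component u i) (component g i).
Proof. by split=> -[gL H]; split=> // ? ?; exact: H. Qed.

(** The working form of H^2 regularity: integration by parts applies to each component, and the
    derivatives are explicit, so that combinations involve no choice. *)
Definition H2_primitives L v d1 d2 := forall i,
  [/\ primitive L (component v i) (component d1 i),
      primitive L (component d1 i) (component d2 i) & sq_integrable L (component d2 i)].

Lemma H2_primitives_line L t u v f1 f2 g1 g2 :
  H2_primitives L u f1 f2 -> H2_primitives L v g1 g2 ->
  H2_primitives L (fun s => u s + t *: v s) (fun s => f1 s + t *: g1 s)
    (fun s => f2 s + t *: g2 s).
Proof.
move=> Hu Hv i; have [pu pf sf] := Hu i; have [pv pg sg] := Hv i.
by rewrite !component_line; split; [exact: primitive_line..|exact: sq_integrable_line].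
Qed.

Lemma eq_primitive L (u v f : R -> R) : 0 < L -> (forall s, s \in `[0, L] -> u s = v s) ->
  primitive L u f -> primitive L v f.
Proof.
move=> L0 uv [jf uf]; split=> // x xL; rewrite -(uv _ xL) -(uv 0) ?(uf _ xL)//.
by rewrite in_itv/= lexx ltW.
Qed.

Section fixed_length.
Variables (L : R) (L0 : 0 < L).

Lemma continuous_L2 u : {within `[0, L], continuous u} -> L2 L u.
Proof.
by move=> /continuous_componentP cu; apply/L2P => i; apply: continuous_sq_integrable.
Qed.

Lemma H2_primitives_weak v d1 d2 : H2_primitives L v d1 d2 ->
  [/\ {within `[0, L], continuous v}, {within `[0, L], continuous d1}, L2 L d2,
      weak_derivative L v d1 & weak_derivative L d1 d2].
Proof.
move=> H; have cv : {within `[0, L], continuous v}.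
  apply/continuous_componentP => i; have [p _ _] := H i.
  exact: primitive_continuous L0 p.
have cd : {within `[0, L], continuous d1}.
  apply/continuous_componentP => i; have [_ p _] := H i.
  exact: primitive_continuous L0 p.
have d2L : L2 L d2 by apply/L2P => i; case: (H i).
split=> //; apply/weak_derivativeP; split=> //.
- exact: continuous_L2.
- by move=> i; have [p _ _] := H i; exact: primitive_scalar_weak_derivative L0 p.
- by move=> i; have [_ p _] := H i; exact: primitive_scalar_weak_derivative L0 p.
Qed.

Lemma scalar_weak_derivative_sub (u g1 g2 : R -> R) :
  sq_integrable L g1 -> sq_integrable L g2 ->
  scalar_weak_derivative L u g1 -> scalar_weak_derivative L u g2 ->
  bump_orthogonal L (fun s => g1 s - g2 s).
Proof.
move=> I1 I2 w1 w2 k a b k0 a0 bL; have tb := test_bump k0 a0 bL.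
have Ib : sq_integrable L (bump k a b).
  apply: continuous_sq_integrable; apply: continuous_subspaceT.
  exact: test_continuous tb.
under eq_Rintegral do rewrite mulrBl.
rewrite RintegralB//; [|exact: sq_integrable_mul..].
by apply/eqP; rewrite subr_eq0 -eqr_opp -w1// -w2.
Qed.

(** Two continuous weak derivatives differ by a continuous function orthogonal to all bumps, so they
    agree up to the endpoints; in particular the boundary value at L is independent of the
    choice. *)
Lemma ds_unique v g : weak_derivative L v g -> {within `[0, L], continuous g} ->
  forall s, s \in `[0, L] -> ds L v s = g s.
Proof.
move=> wg cg s sL.
have [/weak_derivativeP[dL dw] cd] :
    weak_derivative L v (ds L v) /\ {within `[0, L], continuous (ds L v)}.
  by apply: (@xgetPex _ _ [set g | weak_derivative L v g /\
                        {within `[0, L], continuous g}]); exists g.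
move: wg => /weak_derivativeP[gL gw].
apply/rowP => i; apply/eqP; rewrite -subr_eq0; apply/eqP.
apply: (@fundamental_lemma_continuous _ L
  (fun s => component (ds L v) i s - component g i s)) => //.
  move=> y; apply: cvgB.
    by move/continuous_componentP : cd => /(_ i); exact.
  by move/continuous_componentP : cg => /(_ i); exact.
by apply: scalar_weak_derivative_sub (dw i) (gw i); [move/L2P : dL|move/L2P : gL]; exact.
Qed.

Lemma dss_weak_derivative v g : weak_derivative L (ds L v) g ->
  weak_derivative L (ds L v) (dss L v).
Proof.
move=> wg; apply: (@xgetPex _ _ [set g | weak_derivative L (ds L v) g]).
by exists g.
Qed.

Lemma eq_weak_derivative u v g : (forall s, s \in `[0, L] -> u s = v s) ->
  weak_derivative L u g -> weak_derivative L v g.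
Proof.
move=> uv [gL H]; split=> // phi i tphi; rewrite -H//.
apply: eq_Rintegral => s; rewrite mem_setE => sL; rewrite uv//.
by apply: subset_itv_oo_cc.
Qed.

Lemma weak_derivative_normsq u g1 g2 : weak_derivative L u g1 ->
  weak_derivative L u g2 -> L2normsq L g1 = L2normsq L g2.
Proof.
move=> /weak_derivativeP[I1 w1] /weak_derivativeP[I2 w2].
rewrite /L2normsq !L2dotE//; apply: eq_bigr => i _.
have J1 : sq_integrable L (component g1 i) by move/L2P : I1; exact.
have J2 : sq_integrable L (component g2 i) by move/L2P : I2; exact.
have := scalar_weak_derivative_sub J1 J2 (w1 i) (w2 i).
move=> /(@fundamental_lemma_ae R L); have := sq_integrable_line (-1) J1 J2.
move=> /sq_integrable_integrable J; have {J} J : mu.-integrable `]0, L[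
    (EFin \o (fun s => component g1 i s - component g2 i s)).
  have -> : (fun s => component g1 i s - component g2 i s) =
      (fun s => component g1 i s + -1 * component g2 i s).
    by apply/funext => s; rewrite mulN1r.
  apply: (@integrableS _ _ _ mu `[0, L]) => //.
  by apply: subset_itv; rewrite bnd_simp.
move=> /(_ J) ae; congr fine; apply: ae_eq_integral => //.
- by apply/measurable_EFinP; apply: measurable_funM; case: J1.
- by apply/measurable_EFinP; apply: measurable_funM; case: J2.
- move: ae; apply: filterS; first exact: (ae_filter_ringOfSetsType mu).
  move=> s sz sL; have /eqP := sz sL; rewrite subr_eq0 => /eqP.
  by rewrite /= => ->.
Qed.

(** This trades the chosen derivatives of v for explicit ones, pointwise for the first and in norm
    for the second. Applied to a combination, it makes [ds] linear on [0, L]. *)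
Lemma H2_primitives_ds v d1 d2 : H2_primitives L v d1 d2 ->
  [/\ forall s, s \in `[0, L] -> ds L v s = d1 s,
      L2normsq L (dss L v) = L2normsq L d2 & H2_primitives L v (ds L v) (dss L v)].
Proof.
move=> H; have [cv cd d2L w1 w2] := H2_primitives_weak H.
have E := ds_unique w1 cd.
have E' s : s \in `[0, L] -> d1 s = ds L v s by move=> sL; rewrite E.
have w2' := eq_weak_derivative E' w2.
have w2'' := dss_weak_derivative w2'.
split=> //; first exact: weak_derivative_normsq w2'' w2'.
move=> i; have [p1 p2 s2] := H i.
have dL : sq_integrable L (component (dss L v) i).
  by case: w2'' => /L2P.
have Ei s : s \in `[0, L] -> component d1 i s = component (ds L v) i s.
  by move=> sL; rewrite /component E'.
have ci := primitive_continuous L0 p2.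
have pds : primitive L (component (ds L v) i) (component d2 i) by exact: eq_primitive p2.
split=> //.
- case: p1 => [j1 u1]; split.
    by apply: within_continuous_integrable; exact: primitive_continuous pds.
  move=> x xL; rewrite u1//; congr (_ + _); apply: eq_Rintegral => s.
  rewrite mem_setE in_itv/= => /andP[s0 sx]; apply: Ei; rewrite in_itv/= s0.
  by rewrite (le_trans sx)//; move: xL; rewrite in_itv/= => /andP[].
- apply: weak_derivative_primitive => //.
  + exact: primitive_continuous pds.
  + exact: sq_integrable_integrable.
  + by move/weak_derivativeP : w2'' => [_]; exact.
Qed.

(* [H2] does not say that [v] has a continuous weak derivative; the boundary
   condition does, because [ds L v] would be 0 (the default value) otherwise. *)
Lemma calV_H2_primitives eg v : enorm eg = 1 -> calV L eg v ->
  H2_primitives L v (ds L v) (dss L v).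
Proof.
move=> eg1 [[vL [v1 [v2 [w1 w2]]]] cv v0 dvL].
have [wd cd] : weak_derivative L v (ds L v) /\ {within `[0, L], continuous (ds L v)}.
  move: dvL; rewrite /ds; case: xgetP => [g -> //|_ /= e0].
  have : eg = 0 by rewrite -(opprK eg) -e0 oppr0.
  move=> eg0; move: eg1; rewrite eg0 /enorm /dotv big1 => [|i _].
    by rewrite sqrtr0 => /esym/eqP; rewrite oner_eq0.
  by rewrite mxE mul0r.
(* v1 and [ds L v] may differ on a null set, but against phi', itself a test function, both
   integrate to minus the integral of v phi''. So v2 serves for [ds L v] too. *)
have wdd : weak_derivative L (ds L v) v2.
  move: w1 w2 wd => /weak_derivativeP[_ w1] /weak_derivativeP[v2L w2].
  move=> /weak_derivativeP[_ wd].
  apply/weak_derivativeP; split=> // i phi tphi.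
  have tphi' := test_derive1 tphi.
  rewrite -[LHS]opprK -(wd i _ tphi') (w1 i _ tphi') opprK.
  exact: w2.
have := dss_weak_derivative wdd => /weak_derivativeP[ddL wdss] i.
move/weak_derivativeP : wd => [_ wd].
have ci : {within `[0, L], continuous (component (ds L v) i)}.
  by move/continuous_componentP : cd; exact.
split.
- apply: weak_derivative_primitive => //.
  + by move/continuous_componentP : cv; exact.
  + exact: within_continuous_integrable.
- apply: weak_derivative_primitive => //.
  by apply: sq_integrable_integrable; move/L2P : ddL; exact.
- by move/L2P : ddL; exact.
Qed.

End fixed_length.
End H2_regularity.

(** * Energy estimate *)

(** No Gronwall argument is used: on the right the a-terms add up to at most w / (4 N) times their
    total A, so summing the n energy bounds costs w A / 4, half of what the left side provides.
    There are N = n + 1 intervals but n minimisations, the first interval being at rest. *)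
Lemma discrete_energy (R : realType) (n : nat) (w b T K : R) (a B c : nat -> R) :
  0 < w -> 0 < b -> 0 < T -> 0 <= K ->
  (forall k, 0 <= a k) -> (forall k, 0 <= B k) -> (forall k, 0 <= c k) ->
  a 0%N = 0 -> B 0%N = 0 ->
  (forall k, (k < n)%N -> w / 2 * (a k.+1 - a k) + b / 2 * (B k.+1 - B k + c k) <=
     T / n.+1%:R * (K + w / (4 * T) * a k.+1)) ->
  \sum_(k < n) a k.+1 <= 4 * n.+1%:R * T * K / w /\
  \sum_(k < n) c k <= 4 * T * K / b.
Proof.
move=> w0 b0 T0 K0 age0 Bge0 cge0 a0 B0.
have : 0 < n.+1%:R :> R by rewrite ltr0Sn.
have : n%:R <= n.+1%:R :> R by rewrite ler_nat.
move: (n.+1%:R : R) => N nN N0 step.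
have [Nn0 Tn0 wn0 bn0] : [/\ N != 0, T != 0, w != 0 & b != 0] by rewrite !gt_eqF.
pose A := \sum_(k < n) a k.+1.
have A0 : 0 <= A by apply: sumr_ge0.
have energy m : (m <= n)%N ->
    w / 2 * a m + b / 2 * B m + b / 2 * \sum_(k < m) c k <=
    m%:R * (T / N * K) + w / (4 * N) * \sum_(k < m) a k.+1.
  elim: m => [_|m IH mn]; first by rewrite !big_ord0 a0 B0 !mulr0 !addr0 mul0r.
  have := lerD (IH (ltnW mn)) (step m mn); rewrite !big_ord_recr /=.
  rewrite -subr_ge0 => H; rewrite -subr_ge0; apply: (le_trans H).
  rewrite le_eqVlt; apply/orP; left; apply/eqP; rewrite -natr1; field.
  by rewrite Nn0 Tn0.
have partial m : (m <= n)%N -> \sum_(k < m) a k.+1 <= A.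
  move=> mn; rewrite /A -(subnKC mn) big_split_ord /= lerDl.
  by apply: sumr_ge0.
have bound m : (m <= n)%N ->
    w / 2 * a m + b / 2 * B m + b / 2 * \sum_(k < m) c k <= T * K + w / (4 * N) * A.
  move=> mn; apply: (le_trans (energy m mn)); apply: lerD.
    rewrite [leRHS](_ : _ = N * (T / N * K)); last by field.
    apply: ler_wpM2r; last by rewrite (le_trans _ nN)// ler_nat.
    by rewrite mulr_ge0// divr_ge0// ltW.
  by apply: ler_wpM2l; [rewrite ltW// divr_gt0 ?mulr_gt0|exact: partial].
have AA : w / 2 * A <= N * (T * K) + w / 4 * A.
  have : \sum_(k < n) (w / 2 * a k.+1) <= \sum_(k < n) (T * K + w / (4 * N) * A).
    apply: ler_sum => k _; apply: le_trans (bound k.+1 (ltn_ord k)).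
    have b2 : 0 <= b / 2 by rewrite ltW// divr_gt0.
    by rewrite -addrA lerDl; apply: addr_ge0; apply: mulr_ge0 => //; exact: sumr_ge0.
  rewrite -mulr_sumr => H; apply: (le_trans H).
  rewrite sumr_const card_ord -[X in X <= _]mulr_natl.
  rewrite [leRHS](_ : _ = N * (T * K + w / (4 * N) * A)); last by field.
  apply: ler_wpM2r => //; rewrite addr_ge0//; first by rewrite mulr_ge0// ltW.
  by rewrite mulr_ge0// ltW// divr_gt0 ?mulr_gt0.
have Abound : A <= 4 * N * T * K / w.
  by rewrite ler_pdivlMr//; lra.
split=> //; have := bound n (leqnn n).
(* With the bound on A inserted, the right side is 2 T K; dividing by b / 2 gives the factor 4. *)
have wA : w / (4 * N) * A <= T * K.
  rewrite [leRHS](_ : _ = w / (4 * N) * (4 * N * T * K / w)); last first.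
    by field; rewrite wn0 Nn0.
  by apply: ler_wpM2l => //; rewrite ltW// divr_gt0 ?mulr_gt0.
have wa : 0 <= w / 2 * a n by rewrite mulr_ge0// ltW// divr_gt0.
have bB : 0 <= b / 2 * B n by rewrite mulr_ge0// ltW// divr_gt0.
by rewrite ler_pdivlMr//; lra.
Qed.

(** The first-order condition without differentiation: if P > 0, then t = P / (Q + 1) makes the
    quadratic negative. Q + 1 stands in for Q, which may vanish. *)
Lemma le0_of_quadratic_ge0 (R : realType) (P Q : R) : 0 <= Q ->
  (forall t, 0 <= - (2 * t * P) + t ^+ 2 * Q) -> P <= 0.
Proof.
move=> Q0 H; rewrite leNgt; apply/negP => P0.
have Q1 : 0 < Q + 1 by rewrite ltr_wpDl.
have := H (P / (Q + 1)).
have -> : - (2 * (P / (Q + 1)) * P) + (P / (Q + 1)) ^+ 2 * Q =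
    - (P ^+ 2 * (Q + 2) / (Q + 1) ^+ 2) by field; rewrite gt_eqF.
rewrite oppr_ge0 leNgt => /negP; apply.
by rewrite divr_gt0 ?mulr_gt0 ?exprn_gt0//; lra.
Qed.

(* [np], [nm], [nX] stand for |p - q|^2, |q - m|^2, |p - 2 q + m|^2, [bp], [bq],
   [bd] for |p''|^2, |q''|^2, |(p - q)''|^2, and [xd], [pd], [fd], [fp] for the
   inner products (p - 2 q + m, p - q), (p'', (p - q)''), (f, p - q), (f, p).
   The condition on [t] compares [J] at [p] and at [p - t (p - q)]. *)
Lemma energy_algebra (R : realType) (w b tau T np nm nX nf xd fd fp bp bq bd pd : R) :
  0 < w -> 0 < b -> 0 < tau -> 0 < T -> 0 <= np -> 0 <= bd ->
  (forall t,
    w * (tau ^- 2 * (nX + 2 * 0 * xd + 0 ^+ 2 * np)) +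
    b * (bp + 2 * 0 * pd + 0 ^+ 2 * bd) - 2 * (fp + 0 * fd) <=
    w * (tau ^- 2 * (nX + 2 * (- t) * xd + (- t) ^+ 2 * np)) +
    b * (bp + 2 * (- t) * pd + (- t) ^+ 2 * bd) - 2 * (fp + (- t) * fd)) ->
  nm = np + 2 * (-1) * xd + (-1) ^+ 2 * nX ->
  bq = bp + 2 * (-1) * pd + (-1) ^+ 2 * bd ->
  2 * fd <= 2 * tau * T / w * nf + (2 * tau * T / w)^-1 * np -> 0 <= nX ->
  w / 2 * (np / tau ^+ 2 - nm / tau ^+ 2) + b / 2 * (bp - bq + bd) <=
  tau * (T / w * nf + w / (4 * T) * (np / tau ^+ 2)).
Proof.
move=> w0 b0 tau0 T0 np0 bd0 Jt e0 e2 yg X0.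
have t20 : 0 < tau ^- 2 by rewrite invr_gt0 exprn_gt0.
have [taun wn Tn] : [/\ tau != 0, w != 0 & T != 0] by rewrite !gt_eqF.
(* Half the derivative of [J] at p in the direction p - q. *)
pose P := w * tau ^- 2 * xd + b * pd - fd.
have P0 : P <= 0.
  apply: (@le0_of_quadratic_ge0 _ _ (w * tau ^- 2 * np + b * bd)).
    by rewrite addr_ge0// mulr_ge0// ltW// mulr_gt0.
  move=> t; have H := Jt t; rewrite -subr_ge0 in H; apply: (le_trans H).
  by rewrite le_eqVlt; apply/orP; left; apply/eqP; rewrite /P; ring.
have wX : 0 <= w / 2 * tau ^- 2 * nX by rewrite mulr_ge0// ltW// mulr_gt0// divr_gt0.
have -> : tau * (T / w * nf + w / (4 * T) * (np / tau ^+ 2)) =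
    (2 * tau * T / w * nf + (2 * tau * T / w)^-1 * np) / 2.
  by field; rewrite taun wn Tn.
apply: (@le_trans _ _ fd); last by lra.
have -> : fd = w * tau ^- 2 * xd + b * pd - P by rewrite /P; ring.
have -> : w / 2 * (np / tau ^+ 2 - nm / tau ^+ 2) + b / 2 * (bp - bq + bd) =
    w * tau ^- 2 * xd + b * pd - w / 2 * tau ^- 2 * nX.
  by rewrite e0 e2; field.
lra.
Qed.

(** * One time step: the minimality inequality and the linearised constraint *)

Section time_step.
Context {R : realType}.
Notation mu := (@lebesgue_measure R).
Variables (L : R) (L0 : 0 < L) (eg : 'rV[R]_3) (eg1 : enorm eg = 1).
Implicit Types (p q m u v f : R -> 'rV[R]_3).

Definition admissible v :=
  [/\ H2_primitives L v (ds L v) (dss L v), v L = 0 & ds L v L = - eg].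

Lemma calV_admissible v : calV L eg v -> admissible v.
Proof. by move=> vV; split; [exact: calV_H2_primitives eg1 vV|case: vV..]. Qed.

Lemma admissible_calV v : admissible v -> calV L eg v.
Proof.
move=> [H vL dvL]; have [cv cd d2L w1 w2] := H2_primitives_weak L0 H.
split=> //; split; first exact: continuous_L2.
by exists (ds L v), (dss L v).
Qed.

Lemma ds_line t u v : H2_primitives L u (ds L u) (dss L u) ->
  H2_primitives L v (ds L v) (dss L v) ->
  [/\ forall s, s \in `[0, L] ->
        ds L (fun x => u x + t *: v x) s = ds L u s + t *: ds L v s,
      L2normsq L (dss L (fun x => u x + t *: v x)) =
        L2normsq L (fun s => dss L u s + t *: dss L v s) &
      H2_primitives L (fun x => u x + t *: v x) (ds L (fun x => u x + t *: v x))
        (dss L (fun x => u x + t *: v x))].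
Proof. by move=> Hu Hv; exact: H2_primitives_ds (H2_primitives_line t Hu Hv). Qed.

(** The straight fiber has a unit tangent and no bending energy; these are the starting values of
    the telescoping sums. *)
Lemma initial_admissible v : (forall s, s \in `[0, L] -> v s = (L - s) *: eg) ->
  [/\ admissible v, forall s, s \in `[0, L] -> ds L v s = - eg &
      L2normsq L (dss L v) = 0].
Proof.
move=> vE.
have H : H2_primitives L v (fun _ => - eg) (fun _ => 0).
  move=> i; split.
  - apply: (@eq_primitive _ L (fun s => (L - s) * eg 0 i)) => //.
      by move=> s sL; rewrite /component vE// mxE.
    apply: derive_primitive => //; first exact: cst_continuous.
    move=> x; rewrite /component mxE.
    have d0 : is_derive x 1 (fun s : R => L - s) (- 1).
      apply: (is_derive_eq (is_deriveB (is_derive_cst L x 1) (is_derive_id x 1))).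
      by rewrite sub0r.
    apply: (is_derive_eq (is_deriveM d0 (is_derive_cst (eg 0 i) x 1))).
    by rewrite !scaleRE mulr0 add0r mulrN1.
  - apply: derive_primitive => //; first exact: cst_continuous.
    move=> x; rewrite /component; apply: (is_derive_eq (is_derive_cst ((- eg) 0 i) x 1)).
    by rewrite mxE.
  - apply: continuous_sq_integrable; apply: continuous_subspaceT.
    exact: cst_continuous.
have [E N0 HH] := H2_primitives_ds L0 H.
have LL : L \in `[0, L] by rewrite in_itv/= lexx ltW.
split=> //.
  by split=> //; [rewrite vE// subrr scale0r|rewrite E].
rewrite N0 /L2normsq /L2dot; under eq_Rintegral => s _.
  rewrite /dotv big1 => [|i _]; last by rewrite mxE mul0r.
  over.
by rewrite Rintegral_cst// mul0r.
Qed.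

Lemma hardy_littlewood_vector a u u1 u2 : 0 < a -> H2_primitives L u u1 u2 ->
  u L = 0 -> u1 L = 0 ->
  L2normsq L u1 <= a ^+ 2 * L2normsq L u2 + a ^- 2 * L2normsq L u.
Proof.
move=> a0 H uL u1L; have [cu cu1 u2L2 _ _] := H2_primitives_weak L0 H.
have uL2 := continuous_L2 cu; have u1L2 := continuous_L2 cu1.
rewrite /L2normsq !L2dotE// !mulr_sumr -big_split; apply: ler_sum => i _ /=.
have [p1 p2 s2] := H i.
have sq g : sq_integrable L g -> mu.-integrable `]0, L[ (EFin \o (fun s => g s * g s)).
  by case.
have c0 : sq_integrable L (component u i) by move/L2P : uL2; exact.
have c1 : sq_integrable L (component u1 i) by move/L2P : u1L2; exact.
rewrite !Rintegral_itv_oo_cc; [|exact: sq..].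
apply: hardy_littlewood => //.
- by rewrite /component uL mxE.
- by rewrite /component u1L mxE.
- exact: integrable_itv_oo_cc (sq _ s2).
Qed.

Notation sub p q := (fun s => p s + (-1) *: q s).

Lemma constraint_pythagoras p q : admissible q -> calK L eg q p ->
  L2normsq L (ds L p) = L2normsq L (ds L q) + L2normsq L (sub (ds L p) (ds L q)).
Proof.
move=> [Hq qL dqL] [pV pe]; have [Hp pL dpL] := calV_admissible pV.
have [Ed _ _] := ds_line (-1) Hp Hq.
have E s : s \in `]0, L[ -> dotv (ds L p s + (-1) *: ds L q s) (ds L q s) = 0.
  move=> sL; have := pe s sL; rewrite /e_constraint.
  have -> : p \- q = sub p q by apply/funext => x; rewrite scaleN1r.
  rewrite Ed; last exact: subset_itv_oo_cc.
  by move/eqP; rewrite mulf_eq0 pnatr_eq0 /= => /eqP.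
have [_ cdp _ _ _] := H2_primitives_weak L0 Hp.
have [_ cdq _ _ _] := H2_primitives_weak L0 Hq.
have Ip := continuous_L2 cdp; have Iq := continuous_L2 cdq.
have Is := L2_line (-1) Ip Iq.
rewrite /L2normsq /L2dot -RintegralD//; [|exact: integrable_dotv..].
apply: eq_Rintegral => s; rewrite mem_setE => sL.
have pE : ds L p s = ds L q s + 1 *: (ds L p s + (-1) *: ds L q s).
  by rewrite scale1r scaleN1r addrC subrK.
move: (E s sL) pE; move: (ds L p s + _) => d e ->.
rewrite dotv_lineD (dotvC (ds L q s) (_ + _)) (dotvC d (_ + _)) !dotv_lineD.
by rewrite (dotvC (ds L q s) d) e; ring.
Qed.

Lemma subK_line (x y : 'rV[R]_3) : x + (-1) *: (x + (-1) *: y) = y.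
Proof. by rewrite !scaleN1r opprD opprK addNKr. Qed.

Lemma H2_primitives_L2 v : H2_primitives L v (ds L v) (dss L v) ->
  L2 L v /\ L2 L (dss L v).
Proof.
by move=> /(H2_primitives_weak L0)[cv _ v2 _ _]; split=> //; exact: continuous_L2.
Qed.

(** On the line v - q is (1 + t) (p - q), and the constraint is linear in v - q; the direction p - q
    has zero boundary data at L. *)
Lemma calK_line t q p : admissible q -> calK L eg q p ->
  calK L eg q (fun s => p s + t *: (p s + (-1) *: q s)).
Proof.
move=> [Hq qL dqL] [pV pe]; have [Hp pL dpL] := calV_admissible pV.
have LL : L \in `[0, L] by rewrite in_itv/= lexx ltW.
have [Edl _ _] := ds_line (-1) Hp Hq.
have [dv _ Hv] := H2_primitives_ds L0
  (H2_primitives_line t Hp (H2_primitives_line (-1) Hp Hq)).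
split.
  apply: admissible_calV; split=> //.
    by rewrite pL qL !scaler0 addr0 scaler0 addr0.
  by rewrite dv// dpL dqL scaleN1r opprK addNr scaler0 addr0.
move=> s sL; have sL' : s \in `[0, L] by exact: subset_itv_oo_cc.
have := pe s sL; rewrite /e_constraint.
have -> : p \- q = sub p q by apply/funext => x; rewrite scaleN1r.
rewrite Edl//; set v := fun s => p s + _.
have -> : v \- q = sub v q by apply/funext => x; rewrite scaleN1r.
have [Ev _ _] := ds_line (-1) Hv Hq.
rewrite Ev// dv// => /eqP; rewrite mulf_eq0 pnatr_eq0 /= => /eqP e.
rewrite addrAC dotv_lineD e mulr0 addr0 mulr0//.
Qed.

(** With d = p - q and X = d - (q - m), the second difference at the new point is X + t d, and its
    prefactor tau tau^-2 squares to tau^-2. *)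
Lemma J_line w b tau t f m q p : 0 < tau -> L2 L f -> L2 L m ->
  H2_primitives L q (ds L q) (dss L q) -> H2_primitives L p (ds L p) (dss L p) ->
  J L w b tau f m q (fun s => p s + t *: (p s + (-1) *: q s)) =
    w * (tau ^- 2 * (L2normsq L (sub (sub p q) (sub q m)) +
      2 * t * L2dot L (sub (sub p q) (sub q m)) (sub p q) +
      t ^+ 2 * L2normsq L (sub p q))) +
    b * (L2normsq L (dss L p) + 2 * t * L2dot L (dss L p) (sub (dss L p) (dss L q)) +
      t ^+ 2 * L2normsq L (sub (dss L p) (dss L q))) -
    2 * (L2dot L f p + t * L2dot L f (sub p q)).
Proof.
move=> tau0 fL mL2 Hq Hp.
have [pL2 p2L2] := H2_primitives_L2 Hp; have [qL2 q2L2] := H2_primitives_L2 Hq.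
have dlL2 : L2 L (sub p q) by exact: L2_line.
have XL2 : L2 L (sub (sub p q) (sub q m)) by do 2 apply: L2_line => //.
have [_ Edss _] := H2_primitives_ds L0
  (H2_primitives_line t Hp (H2_primitives_line (-1) Hp Hq)).
congr (w * _ + b * _ - 2 * _).
- rewrite -(L2normsq_line t XL2 dlL2).
  have ZL2 := L2_line t XL2 dlL2.
  rewrite /L2normsq /L2dot -RintegralZl//; last exact: integrable_dotv.
  apply: eq_Rintegral => s _; rewrite /D2 /dotv mulr_sumr.
  by apply: eq_bigr => i _; rewrite !mxE; field; rewrite gt_eqF.
- apply: (etrans Edss); apply: L2normsq_line => //; exact: L2_line.
- rewrite L2dotC (L2dotC L f p) (L2dotC L f (sub p q)).
  exact: (L2dot_line t pL2 dlL2 fL).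
Qed.

Lemma energy_step w b tau T f m q p : 0 < w -> 0 < b -> 0 < tau -> 0 < T ->
  L2 L f -> L2 L m -> admissible q ->
  is_minimizer (J L w b tau f m q) (calK L eg q) p ->
  w / 2 * (L2normsq L (sub p q) / tau ^+ 2 - L2normsq L (sub q m) / tau ^+ 2) +
  b / 2 * (L2normsq L (dss L p) - L2normsq L (dss L q) +
           L2normsq L (sub (dss L p) (dss L q))) <=
  tau * (T / w * L2normsq L f + w / (4 * T) * (L2normsq L (sub p q) / tau ^+ 2)).
Proof.
move=> w0 b0 tau0 T0 fL mL2 aq [pK pmin].
have [Hq qL dqL] := aq; have [Hp pL dpL] := calV_admissible pK.1.
have [pL2 p2L2] := H2_primitives_L2 Hp; have [qL2 q2L2] := H2_primitives_L2 Hq.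
have dlL2 : L2 L (sub p q) by exact: L2_line.
have dl0L2 : L2 L (sub q m) by exact: L2_line.
have dl2L2 : L2 L (sub (dss L p) (dss L q)) by exact: L2_line.
have XL2 : L2 L (sub (sub p q) (sub q m)) by exact: L2_line.
(* With this Young weight the load costs, after halving, tau w / (4 T) times the squared discrete
   velocity: the share that [discrete_energy] can absorb. *)
have c0 : 0 < 2 * tau * T / w by rewrite divr_gt0 ?mulr_gt0.
have yg := L2dot_young c0 fL dlL2.
have X0 := L2normsq_ge0 L (sub (sub p q) (sub q m)).
have dl_ge0 := L2normsq_ge0 L (sub p q).
have dl2_ge0 := L2normsq_ge0 L (sub (dss L p) (dss L q)).
(* With d = p - q and X = d - (q - m), one has q - m = d - X. Expanding the square trades the inner
   product of X and d for squared velocities, which telescope in time; [e2] does the same for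
   bending. *)
have e0 : L2normsq L (sub q m) = L2normsq L (sub p q) +
    2 * (-1) * L2dot L (sub (sub p q) (sub q m)) (sub p q) +
    (-1) ^+ 2 * L2normsq L (sub (sub p q) (sub q m)).
  rewrite L2dotC -(L2normsq_line (-1) dlL2 XL2); apply: eq_L2normsq => s _.
  exact/esym/subK_line.
have e2 : L2normsq L (dss L q) = L2normsq L (dss L p) +
    2 * (-1) * L2dot L (dss L p) (sub (dss L p) (dss L q)) +
    (-1) ^+ 2 * L2normsq L (sub (dss L p) (dss L q)).
  rewrite -(L2normsq_line (-1) p2L2 dl2L2); apply: eq_L2normsq => s _.
  exact/esym/subK_line.
have Jt t := pmin _ (calK_line (- t) aq pK).
(* p is the point t = 0 of the line, so [J_line] expands both sides of the minimality inequality. *)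
have Jp : J L w b tau f m q p =
    J L w b tau f m q (fun s => p s + 0 *: (p s + (-1) *: q s)).
  by congr J; apply/funext => s; rewrite scale0r addr0.
have {Jp}Jt t := etrans (congr2 (@Order.le _ R) (esym (etrans Jp
  (J_line w b 0 tau0 fL mL2 Hq Hp))) (esym (J_line w b (- t) tau0 fL mL2 Hq Hp))) (Jt t).
exact: (energy_algebra w0 b0 tau0 T0 dl_ge0 dl2_ge0 Jt e0 e2 yg X0).
Qed.

End time_step.

(** * Bounds on the loads, uniform in time *)

Section loads.
Context {R : realType}.
Notation mu := (@lebesgue_measure R).
Variables (L T : R) (L0 : 0 < L) (f : R * R -> 'rV[R]_3).
Hypothesis cf : {within `[0, L] `*` `[0, T], continuous f}.

Lemma slice_continuous t : t \in `[0, T] ->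
  {within `[0, L], continuous (fun s => f (s, t))}.
Proof.
move=> tT; apply/subspace_continuousP => s sL.
have /subspace_continuousP/(_ (s, t)) H := cf.
apply: (@cvg_comp _ _ _ (fun s => (s, t)) f) (H _) => //.
move=> U /=; rewrite /within/= => -[[A B] /= [As Bt] AB].
apply: filterS As => x Ax xL; apply: (AB (x, t)); split=> //=.
exact: nbhs_singleton Bt.
Qed.

Lemma load_bound : exists2 F : R, 0 <= F & forall t, t \in `[0, T] ->
  L2 L (fun s => f (s, t)) /\ L2normsq L (fun s => f (s, t)) <= F.
Proof.
have cd : {within `[0, L] `*` `[0, T], continuous (fun z => dotv (f z) (f z))}.
  have cc i : {within `[0, L] `*` `[0, T], continuous (fun z => f z 0 i)}.
    move=> z; apply: (@continuous_cvg _ _ _ _ _ (from_subspace _ f)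
      (fun M : 'rV[R]_3 => M 0 i)).
      exact: coord_continuous.
    exact: cf.
  have -> : (fun z => dotv (f z) (f z)) = (fun z => f z 0 0 * f z 0 0 +
      (f z 0 (lift 0 0) * f z 0 (lift 0 0) +
       f z 0 (lift 0 (lift 0 0)) * f z 0 (lift 0 (lift 0 0)))).
    by apply/funext => z; rewrite /dotv !big_ord_recl big_ord0 addr0.
  by move=> z; apply: cvgD; [|apply: cvgD]; apply: cvgM; exact: cc.
have cpt : compact (`[0, L] `*` `[0, T] : set (R * R)).
  by apply: compact_setX; exact: segment_compact.
have [M [_ HM]] := compact_bounded (continuous_compact cd cpt).
pose M' := `|M| + 1.
have M'0 : 0 <= M' by rewrite addr_ge0.
have bM s t : s \in `[0, L] -> t \in `[0, T] -> dotv (f (s, t)) (f (s, t)) <= M'.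
  move=> sL tT; apply: le_trans (ler_norm _) _; apply: (HM M').
    by rewrite (le_lt_trans (ler_norm _))// ltrDl.
  by exists (s, t).
exists (M' * L); first by rewrite mulr_ge0// ltW.
move=> t tT; have fL : L2 L (fun s => f (s, t)).
  by apply: continuous_L2; exact: slice_continuous.
split=> //.
have -> : M' * L = \int[mu]_(s in `]0, L[) M'.
  by rewrite Rintegral_cst//= lebesgue_measure_itv/= lte_fin L0 sube0.
apply: le_Rintegral => //.
- exact: integrable_dotv.
- apply: (@integrableS _ _ _ mu `[0, L]) => //.
    by apply: subset_itv; rewrite bnd_simp.
  apply: within_continuous_integrable; apply: continuous_subspaceT.
  exact: cst_continuous.
- by move=> s sL; apply: bM => //; exact: subset_itv_oo_cc.
Qed.

End loads.

(** * Summation over the time steps and the final estimate *)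

Lemma telescope_le (R : realType) (x y : R) (g c a : nat -> R) (n : nat) :
  (forall k, (k < n)%N -> g k.+1 <= g k + (x * c k + y * a k)) ->
  g n <= g 0%N + (x * \sum_(k < n) c k + y * \sum_(k < n) a k).
Proof.
elim: n => [_|n IH H]; first by rewrite !big_ord0 !mulr0 !addr0.
rewrite !big_ord_recr /=; have := H n (ltnSn n).
have := IH (fun k kn => H k (ltnW kn)); lra.
Qed.

Lemma interpolation_final (R : realType) (tau : R) (n : nat) (r : nat -> R -> 'rV[R]_3) :
  0 < tau -> (fun x => interpolation tau r x (n.+1%:R * tau)) = r n.+1.
Proof.
move=> tau0; apply/funext => x; rewrite /interpolation mulfK ?gt_eqF//.
have -> : Num.ceil (n.+1%:R : R) = n.+1 by rewrite -[n.+1%:R]/(n.+1%:Z%:~R) intrKceil.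
rewrite absz_nat /= -mulrBl -natrB ?leqnSn// subSnn mul1r divff ?gt_eqF//.
by rewrite scale1r subrK.
Qed.

Unset Implicit Arguments.

Theorem proposition9 (R : realType) (L T w b : R) (eg : 'rV[R]_3)
  (f : R * R -> 'rV[R]_3)
  (hL : 0 < L) (hT : 0 < T) (hw : 0 < w) (hb : 0 < b)
  (heg : enorm eg = 1)
  (hf : {within `[0, L] `*` `[0, T], continuous f}) :
  exists C : R, 0 < C /\
    forall (N : nat) (r : nat -> R -> 'rV[R]_3),
      (0 < N)%N -> discrete_solution L T w b eg f N r ->
      let tau := T / N%:R in
      let rtau := interpolation tau r in
      \int[@lebesgue_measure R]_(s in `]0, L[)
        (enorm (ds L (fun x => rtau x (N%:R * tau)) s) ^+ 2 - 1)
      <= C * Num.sqrt tau.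
Proof.
have [F F0 HF] := load_bound hL hf.
pose K := T / w * F.
have K0 : 0 <= K by rewrite mulr_ge0// ltW// divr_gt0.
(* The two fractions are the bounds of [discrete_energy] times the Hardy-Littlewood weights, divided
   by sqrt tau; in the second, N = T / tau. The 1 gives positivity when K = 0. *)
exists (4 * T * K / b + 4 * T ^+ 2 * K / w + 1); split.
  have T0 := ltW hT.
  have C1 : 0 <= 4 * T * K / b by rewrite divr_ge0 ?(ltW hb)// (mulr_ge0 _ K0)// mulr_ge0.
  have C2 : 0 <= 4 * T ^+ 2 * K / w.
    by rewrite divr_ge0 ?(ltW hw)// (mulr_ge0 _ K0)// mulr_ge0// sqr_ge0.
  by rewrite ltr_wpDl// addr_ge0.
case=> [|n] r; first by [].
move=> _ [r0E r1E rmin]; lazy zeta; set tau := T / n.+1%:R in rmin *.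
have tau0 : 0 < tau by rewrite divr_gt0// ltr0Sn.
rewrite interpolation_final//.
have [[H0 _ _] _ _] := initial_admissible hL r0E.
have [a1 ds1 dss1] := initial_admissible hL r1E.
have step k : (k < n)%N ->
    is_minimizer (J L w b tau (fun s => f (s, k.+2%:R * tau)) (r k) (r k.+1))
      (calK L eg (r k.+1)) (r k.+2).
  by move=> kn; exact: (rmin k.+1).
have adm k : (k <= n)%N -> admissible L eg (r k.+1).
  case: k => [//|k kn]; apply: calV_admissible => //.
  by case: (step k kn) => -[].
have rL2 k : (k <= n)%N -> L2 L (r k).
  case: k => [_|k kn]; first by case: (H2_primitives_L2 hL H0).
  by have [H _ _] := adm k (ltnW kn); case: (H2_primitives_L2 hL H).
pose sub (p q : R -> 'rV[R]_3) := fun s => p s + (-1) *: q s.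
(* Index shift: [a k] is the squared velocity from level k to k + 1 and [B k] the bending at level k
   + 1, so both start at 0. [c k] comes from the minimisation producing [r k.+2] and is paired with
   [a k.+1]. *)
pose a k := L2normsq L (sub (r k.+1) (r k)) / tau ^+ 2.
pose B k := L2normsq L (dss L (r k.+1)).
pose c k := L2normsq L (sub (dss L (r k.+2)) (dss L (r k.+1))).
have [|||||k kn|Asum Csum] := @discrete_energy R n w b T K a B c hw hb hT K0.
- by move=> k; rewrite divr_ge0 ?sqr_ge0 ?L2normsq_ge0.
- by move=> k; exact: L2normsq_ge0.
- by move=> k; exact: L2normsq_ge0.
- rewrite /a (_ : L2normsq _ _ = 0) ?mul0r//.
  rewrite /L2normsq /L2dot; under eq_Rintegral => s.
    rewrite mem_setE => sL; have sL' : s \in `[0, L] by exact: subset_itv_oo_cc.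
    rewrite /sub r0E// r1E// scaleN1r subrr.
    rewrite /dotv big1 => [|i _]; last by rewrite mxE mul0r.
    over.
  by rewrite Rintegral_cst// mul0r.
- exact: dss1.
- have tk : k.+2%:R * tau \in `[0, T].
    rewrite in_itv/=; apply/andP; split; first by rewrite mulr_ge0// ltW.
    rewrite /tau mulrA ler_pdivrMr ?ltr0Sn// mulrC.
    by apply: ler_wpM2l; [exact: ltW|rewrite ler_nat].
  have [fL fF] := HF _ tk.
  apply: (le_trans (energy_step hL heg hw hb tau0 hT fL (rL2 k (ltnW kn))
    (adm k (ltnW kn)) (step k kn))).
  apply: ler_wpM2l; first exact: ltW.
  by apply: lerD => //; apply: ler_wpM2l => //; rewrite ltW// divr_gt0.
pose g k := L2normsq L (ds L (r k.+1)).
pose lam := Num.sqrt tau.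
have lam0 : 0 < lam by rewrite sqrtr_gt0.
(* The Hardy-Littlewood parameter enters squared and its square is to be sqrt tau, hence a fourth
   root. *)
pose al := Num.sqrt lam.
have al0 : 0 < al by rewrite sqrtr_gt0.
have al2 : al ^+ 2 = lam by rewrite sqr_sqrtr// ltW.
have lam2 : lam ^+ 2 = tau by rewrite sqr_sqrtr// ltW.
have gstep k : (k < n)%N -> g k.+1 <= g k + (lam * c k + lam^-1 * tau ^+ 2 * a k.+1).
  move=> kn; have [Hq qL dqL] := adm k (ltnW kn); have [Hp pL dpL] := adm k.+1 kn.
  rewrite /g (constraint_pythagoras hL heg (adm k (ltnW kn)) (step k kn).1) lerD2l.
  rewrite -mulrA; have -> : tau ^+ 2 * a k.+1 = L2normsq L (sub (r k.+2) (r k.+1)).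
    by rewrite /a mulrC divfK// expf_neq0// gt_eqF.
  rewrite -al2; apply: hardy_littlewood_vector => //.
  - exact: H2_primitives_line Hp Hq.
  - by rewrite /sub pL qL scaler0 addr0.
  - by rewrite /sub dpL dqL scaleN1r subrr.
have gn := telescope_le gstep.
(* The initial tangent has unit length, so [g 0] accounts for the 1 subtracted in the integrand. *)
have g0 : g 0%N = \int[@lebesgue_measure R]_(s in `]0, L[) 1.
  apply: eq_Rintegral => s; rewrite mem_setE => sL.
  rewrite ds1; last exact: subset_itv_oo_cc.
  rewrite -[RHS](expr1n _ 2) -heg sqr_sqrtr ?dotv_ge0//.
  by apply: eq_bigr => i _; rewrite !mxE mulrNN.
have [Hn _ _] := adm n (leqnn n).
have [_ cdn _ _ _] := H2_primitives_weak hL Hn.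
have dnL2 := continuous_L2 cdn.
rewrite (_ : Rintegral _ _ _ = g n - g 0%N); last first.
  rewrite g0 /g /L2normsq /L2dot -RintegralB//; first last.
  - apply: (@integrableS _ _ _ (@lebesgue_measure R) `[0, L]) => //.
      by apply: subset_itv; rewrite bnd_simp.
    apply: within_continuous_integrable; apply: continuous_subspaceT.
    exact: cst_continuous.
  - exact: (integrable_dotv dnL2 dnL2).
  by apply: eq_Rintegral => s _; rewrite sqr_sqrtr// dotv_ge0.
rewrite lerBlDl; apply: (le_trans gn); rewrite lerD2l.
apply: (@le_trans _ _ (lam * (4 * T * K / b) +
    lam^-1 * tau ^+ 2 * (4 * n.+1%:R * T * K / w))).
  apply: lerD; apply: ler_wpM2l => //; first exact: ltW.
  by rewrite mulr_ge0 ?sqr_ge0// invr_ge0 ltW.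
have -> : lam^-1 * tau ^+ 2 * (4 * n.+1%:R * T * K / w) = lam * (4 * T ^+ 2 * K / w).
  have -> : n.+1%:R = T / tau :> R.
    by rewrite /tau invfM invrK mulrA divff ?gt_eqF// mul1r.
  by rewrite -lam2; field; rewrite !gt_eqF.
rewrite -mulrDr [leRHS]mulrC -/lam; apply: ler_wpM2l; first exact: ltW.
by rewrite lerDl.
Qed.
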